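(* Let $G={\rm C}_4\rtimes{\rm C}_4=\langle g_1,g_2\mid g_1^4=g_2^4=e,\ g_2g_1=g_1^3g_2\rangle$ and let $S(G)=\{\Theta_G(x_g)\mid x_g\in\mathbb{Z}\}$ be the set of values of its integer group determinant. Let $P=\{p\mid p \text{ is a prime with } p\equiv -3 \pmod 8\}$, $P'=\{p\mid p\text{ is a prime with } p\equiv -1\pmod 4\}$, and $$A=\{(8k-3)(8l-3)(4m-1)^2\mid k,m\in\mathbb{Z},\ m\ge 1,\ 8l-3\in P,\ k+l\equiv m \pmod 2\}.$$ Then $A\subsetneq\{16m-7\mid m\in\mathbb{Z}\}$, and $$S({\rm C}_4\rtimes{\rm C}_4)=\{16m+1,\ 2^{14}p(2m+1),\ 2^{14}q^2(2m+1),\ 2^{15}m\mid m\in\mathbb{Z},\ p\in P,\ q\in P'\}\cup A.$$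
   Context: For a finite group $G$ with a variable $x_g$ for each $g\in G$, the group determinant is $\Theta_G(x_g)=\det(x_{gh^{-1}})_{g,h\in G}\in\mathbb{Z}[x_g]$. $S(G)$ is the set of values of $\Theta_G$ when all variables are integers. $e$ denotes the identity element. *)

(* Defs.v *)
From mathcomp Require Import all_boot all_order all_fingroup all_algebra.
From mathcomp Require Import classical_sets.

Set Implicit Arguments.
Unset Strict Implicit.
Unset Printing Implicit Defensive.

Import GRing.Theory.

Local Open Scope classical_set_scope.
Local Open Scope ring_scope.

(* Rows and columns are both indexed through the same enumeration of G, so the
   determinant does not depend on that enumeration. Only the values of x on G
   matter. *)
Definition group_det (gT : finGroupType) (G : {group gT}) (R : comNzRingType)
    (x : gT -> R) : R :=
  \det (\matrix_(i < #|G|, j < #|G|) x (enum_val i * (enum_val j)^-1)%g).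

Definition int_group_dets (gT : finGroupType) (G : {group gT}) : set int :=
  [set group_det G x | x in [set: gT -> int]].

Definition primes_m3_mod8 : set nat :=
  [set p : nat | prime p /\ (p%:Z = -3 %[mod 8])%Z].

Definition primes_m1_mod4 : set nat :=
  [set p : nat | prime p /\ (p%:Z = -1 %[mod 4])%Z].

Definition odd_exceptional_dets : set int :=
  [set n : int | exists k l m : int,
     [/\ 1 <= m,
         exists2 p : nat, primes_m3_mod8 p & 8 * l - 3 = p%:Z,
         (k + l = m %[mod 2])%Z
       & n = (8 * k - 3) * (8 * l - 3) * (4 * m - 1) ^+ 2]].

(* Main.v *)
Require Import Defs.
From mathcomp Require Import all_boot all_order all_fingroup all_algebra all_field.
From mathcomp Require Import classical_sets.
From mathcomp Require Import ring zify.

(* Write a, b for the generators. The involutions a^2 and b^2 are central, so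
   splitting the group matrix along their four joint sign characters gives
   four Klein-type 4 x 4 determinants, and
     Theta = F1 F2 F3 F4 D1^2 D2^2
   where F1, F2 are differences and F3, F4 sums of two squares of linear forms,
   while D1 (resp. D2) is an indefinite (resp. definite) quaternary diagonal
   form. The linear forms come in four quadruples (one for each of the cosets
   of 1, a, b, ab modulo the center); the only integrality condition on a
   quadruple is that its entries have the same parity and a sum divisible by 4.
   A case analysis on the parities of the four quadruples gives the possible
   values: a prime 5 mod 8 appears as a factor of a sum of two squares that is
   5 mod 8, and the square of an integer 3 mod 4 comes from D2^2.
   Conversely, each listed value is reached by solving F3 F4 = p or 4 p with
   Fermat's two-square theorem and D2 = 4 m - 1 or D2 = 2 q with Lagrange's
   four-square theorem. *)

Set Implicit Arguments.
Unset Strict Implicit.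
Unset Printing Implicit Defensive.

Import Order.TTheory GRing.Theory Num.Theory.

Local Open Scope classical_set_scope.
Local Open Scope ring_scope.

(** * The presentation and its order *)

(** Right multiplication by the generators on the normal forms [g2 ^+ j * g1 ^+ i], coded as pairs
    [(i, j)]. *)
Definition shift_fst (u : 'Z_4 * 'Z_4) : 'Z_4 * 'Z_4 := (u.1 + 1, u.2).
Definition flip_shift_snd (u : 'Z_4 * 'Z_4) : 'Z_4 * 'Z_4 := (- u.1, u.2 + 1).

Lemma shift_fst_inj : injective shift_fst.
Proof.
move=> [i j] [k l] e.
by rewrite (addIr _ (congr1 fst e) : i = k) (congr1 snd e : j = l).
Qed.

Lemma flip_shift_snd_inj : injective flip_shift_snd.
Proof.
move=> [i j] [k l] e.
by rewrite (oppr_inj (congr1 fst e) : i = k) (addIr _ (congr1 snd e) : j = l).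
Qed.

(** The relations alone bound the order only from above. The two permutations satisfy them and move
    [(0, 0)] to all sixteen points, so a homomorphic image of [G] has at least 16 elements. *)
Lemma order_ge16 (gT : finGroupType) (G : {group gT}) :
  (G \isog Grp (g1 : g2 : g1 ^+ 4 = g2 ^+ 4 = 1, g2 * g1 = g1 ^+ 3 * g2))%g ->
  (16 <= #|G|)%N.
Proof.
move=> isoG.
pose x := perm shift_fst_inj; pose y := perm flip_shift_snd_inj.
have xE i j : x (i, j) = (i + 1, j)%R by rewrite permE.
have yE i j : y (i, j) = (- i, j + 1)%R by rewrite permE.
pose H := (<[x]> <*> <[y]>)%G.
have/card_homg : (H \homg G)%g.
  rewrite isoG; apply/existsP; exists (x, y) => /=.
  rewrite !xpair_eqE /= eqxx /= ?andbT.
  by apply/and3P; split; apply/eqP/permP => -[i j];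
    rewrite ?expgS ?expg0 ?mulg1 !permM ?xE ?yE ?xE ?perm1; congr (_, _);
    rewrite ?opprK //; apply/val_inj;
    try (by case: i => [[|[|[|[|]]]] ?]); case: j => [[|[|[|[|]]]] ?].
move/dvdn_leq => /(_ (cardG_gt0 _)); apply: leq_trans.
have xiE i : (x ^+ i)%g (0, 0) = (i%:R, 0).
  by elim: i => [|i IH]; rewrite ?expg0 ?perm1 // expgSr permM IH xE -natr1.
have yjE j u : (y ^+ j)%g (u, 0) = ((-1) ^+ j * u, j%:R).
  elim: j => [|j IH]; first by rewrite expg0 perm1 mul1r.
  by rewrite expgSr permM IH yE -natr1 exprS mulN1r mulNr.
have <- : #|[set: 'Z_4 * 'Z_4]%SET| = 16%N by rewrite cardsT card_prod !card_ord.
apply: leq_trans (leq_imset_card (fun g : {perm _} => g (0, 0)) _).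
apply/subset_leq_card/fintype.subsetP => -[i j] _; apply/imsetP.
(* [y ^+ j] multiplies the first coordinate by [(-1) ^+ j]; the exponent compensates this sign. *)
pose k : 'Z_4 := (-1) ^+ j * i; exists (x ^+ k * y ^+ j)%g.
  by rewrite groupM // groupX // mem_gen // inE ?cycle_id ?orbT.
by rewrite permM xiE yjE !natr_Zp mulrA -exprD addnn -signr_odd odd_double mul1r.
Qed.

(** * Splitting the group determinant *)

Lemma det_mx4 (R : comNzRingType) (f : nat -> nat -> R) :
  \det (\matrix_(i < 4, j < 4) f i j) =
    f 0 0 * (f 1 1 * (f 2 2 * f 3 3 - f 2 3 * f 3 2)
           - f 1 2 * (f 2 1 * f 3 3 - f 2 3 * f 3 1)
           + f 1 3 * (f 2 1 * f 3 2 - f 2 2 * f 3 1))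
  - f 0 1 * (f 1 0 * (f 2 2 * f 3 3 - f 2 3 * f 3 2)
           - f 1 2 * (f 2 0 * f 3 3 - f 2 3 * f 3 0)
           + f 1 3 * (f 2 0 * f 3 2 - f 2 2 * f 3 0))
  + f 0 2 * (f 1 0 * (f 2 1 * f 3 3 - f 2 3 * f 3 1)
           - f 1 1 * (f 2 0 * f 3 3 - f 2 3 * f 3 0)
           + f 1 3 * (f 2 0 * f 3 1 - f 2 1 * f 3 0))
  - f 0 3 * (f 1 0 * (f 2 1 * f 3 2 - f 2 2 * f 3 1)
           - f 1 1 * (f 2 0 * f 3 2 - f 2 2 * f 3 0)
           + f 1 2 * (f 2 0 * f 3 1 - f 2 1 * f 3 0)) :> R.
Proof.
do 3 (rewrite !(expand_det_row _ ord0) !big_ord_recl !big_ord0 /cofactor).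
rewrite !det_mx11 !mxE /= /bump /=.
ring.
Qed.

(** Factoring through unipotent block matrices avoids halving, so any commutative ring will do. *)
Lemma det_block_sym (R : comNzRingType) n (A B : 'M[R]_n) :
  \det (block_mx A B B A) = \det (A + B) * \det (A - B).
Proof.
have -> : block_mx A B B A =
    block_mx 1%:M 0 1%:M 1%:M *m block_mx (A + B) B 0 (A - B)
      *m block_mx 1%:M 0 (- 1%:M) 1%:M.
  rewrite !mulmx_block !mul1mx !mul0mx !mulmx1 !mulmx0 !mulmxN !mulmx1.
  by congr block_mx; apply/matrixP => i j; rewrite !mxE; ring.
by rewrite !det_mulmx !det_lblock det_ublock !det1 !mul1r !mulr1.
Qed.

Section DifferenceMatrix.
Variables (gT : finGroupType) (R : comNzRingType).
Implicit Types (G : {group gT}) (x : gT -> R).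

Definition diff_mx n (h : 'I_n -> gT) x : 'M[R]_n :=
  \matrix_(i, j) x (h i * (h j)^-1)%g.

(** Two enumerations of [G] differ by one permutation of both rows and columns, whose sign occurs
    twice. *)
Lemma group_det_diff_mx G n (h : 'I_n -> gT) x :
  #|G| = n -> injective h -> (forall i, h i \in G) ->
  group_det G x = \det (diff_mx h x).
Proof.
move=> oG; case: n / oG h => h injh Gh.
have injr : injective (fun i => enum_rank_in (group1 G) (h i)).
  by move=> i j /(congr1 enum_val); rewrite !enum_rankK_in // => /injh.
have hE i : h i = enum_val (perm injr i) by rewrite permE enum_rankK_in.
have -> : diff_mx h x = row_perm (perm injr) (col_perm (perm injr)
            (\matrix_(i, j) x (enum_val i * (enum_val j)^-1)%g)).
  by apply/matrixP => i j; rewrite !mxE !hE.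
rewrite row_permE col_permE !det_mulmx !det_perm. 
by rewrite [X in _ * X]mulrC mulrA -signr_addb odd_permV addbb mul1r.
Qed.

Definition double_enum (z : gT) n (h : 'I_n -> gT) (i : 'I_(n + n)) : gT :=
  match split i with inl j => h j | inr j => z * h j end%g.

Lemma double_enum_lshift z n (h : 'I_n -> gT) i :
  double_enum z h (lshift n i) = h i.
Proof. by rewrite /double_enum (unsplitK (inl i)). Qed.

Lemma double_enum_rshift z n (h : 'I_n -> gT) i :
  double_enum z h (rshift n i) = (z * h i)%g.
Proof. by rewrite /double_enum (unsplitK (inr i)). Qed.

(** A commuting involution gives the block form A B B A. The two new functions are twice the even
    and odd parts of [x] under translation by [z]. *)
Lemma det_diff_mx_double (z : gT) n (h : 'I_n -> gT) x :
  (z * z = 1)%g -> (forall i, commute z (h i)) ->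
  \det (diff_mx (double_enum z h) x) =
    \det (diff_mx h (fun g => x g + x (z * g)%g))
    * \det (diff_mx h (fun g => x g - x (z * g)%g)).
Proof.
move=> zz cz; have zV : (z^-1 = z)%g by apply/eqP; rewrite eq_invg_mul zz.
pose A := diff_mx h x; pose B := diff_mx h (fun g => x (z * g)%g).
have -> : diff_mx (double_enum z h) x = block_mx A B B A.
  apply/matrixP => i j; rewrite -(splitK i) -(splitK j).
  case: (split i) (split j) => i' [] j' /=;
    rewrite ?(block_mxEul, block_mxEur, block_mxEdl, block_mxEdr) !mxE
      ?double_enum_lshift ?double_enum_rshift ?invMg ?zV ?mulgA //.
  - by rewrite -2!mulgA -(commuteV (cz j')) mulgA (cz i') mulgA.
  - by rewrite (cz i') -!mulgA -(commuteV (cz j')) (mulgA z) zz mul1g.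
rewrite det_block_sym; by congr (_ * _); congr (\det _); apply/matrixP => i j;
  rewrite !mxE.
Qed.

End DifferenceMatrix.

(** For [s = t = 1] this is the group matrix of the Klein four-group. The scalars record the powers
    of a^2 and b^2 split off when a quotient of two representatives is reduced to a
    representative. *)
Definition twisted_klein (R : comNzRingType) (s t c0 c1 c2 c3 : R) (i j : nat) : R :=
  nth 0 (nth [::] [:: [:: c0; s * c1; t * c2; t * c3];
                      [:: c1; c0; t * c3; s * t * c2];
                      [:: c2; c3; c0; s * c1];
                      [:: c3; s * c2; c1; c0]] i) j.

(** For [s = -1] the matrix describes multiplication in a quaternion algebra, hence the square of a
    reduced norm. Bundling the equations as a product lets [rewrite] select the matching one. *)
Lemma det_twisted_klein (R : comNzRingType) (c0 c1 c2 c3 : R) :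
  let M (s t : R) := \matrix_(i < 4, j < 4) twisted_klein s t c0 c1 c2 c3 i j in
  (\det (M 1 1) = ((c0 + c1) ^+ 2 - (c2 + c3) ^+ 2) * ((c0 - c1) ^+ 2 - (c2 - c3) ^+ 2))
  * (\det (M 1 (-1)) = ((c0 + c1) ^+ 2 + (c2 + c3) ^+ 2) * ((c0 - c1) ^+ 2 + (c2 - c3) ^+ 2))
  * (\det (M (-1) 1) = (c0 ^+ 2 + c1 ^+ 2 - c2 ^+ 2 - c3 ^+ 2) ^+ 2)
  * (\det (M (-1) (-1)) = (c0 ^+ 2 + c1 ^+ 2 + c2 ^+ 2 + c3 ^+ 2) ^+ 2).
Proof. by move=> M; rewrite /M !det_mx4 /twisted_klein /=; do !split; ring. Qed.

(* A function that transforms by the scalars [s] and [t] under the central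
   involutions a^2 and b^2 is determined by its values on {1, a, b, ab}, a
   transversal of the center <a^2, b^2>. *)
Lemma det_diff_mx_central (gT : finGroupType) (R : comNzRingType)
    (y : gT -> R) (s t : R) (a b : gT) :
  (a ^+ 4 = 1)%g -> (b ^+ 4 = 1)%g -> (b * a = a ^+ 3 * b)%g ->
  (forall g, y (a ^+ 2 * g)%g = s * y g) ->
  (forall g, y (b ^+ 2 * g)%g = t * y g) ->
  \det (diff_mx (tnth [tuple 1%g; a; b; (a * b)%g]) y) =
  \det (\matrix_(i < 4, j < 4)
    twisted_klein s t (y 1%g) (y a) (y b) (y (a * b)%g) i j).
Proof.
move=> a4 b4 ba yz yw.
have aV : (a^-1 = a ^+ 3)%g by apply/eqP; rewrite eq_invg_mul -expgS a4.
have bV : (b^-1 = b ^+ 3)%g by apply/eqP; rewrite eq_invg_mul -expgS b4.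
have ba' u : (b * (a * u) = a ^+ 3 * (b * u))%g by rewrite mulgA ba !mulgA.
have a4' u : (a * (a * (a * (a * u))) = u)%g.
  by rewrite -[RHS]mul1g -a4 !expgS expg0 mulg1 -!mulgA.
have b4' u : (b * (b * (b * (b * u))) = u)%g.
  by rewrite -[RHS]mul1g -b4 !expgS expg0 mulg1 -!mulgA.
have b4e : (b * (b * (b * b)) = 1)%g by rewrite -b4.
congr (\det _); apply/matrixP => i j; rewrite !mxE !(tnth_nth 1%g).
(* The scalars are absorbed into the argument of [y]; what remains are identities between words,
   settled by moving [b] to the right and cancelling fourth powers. *)
case: i => [[|[|[|[|//]]]] ?]; case: j => [[|[|[|[|//]]]] ?];
 rewrite /twisted_klein /= -?mulrA -?yw -?yz; congr (y _);
 rewrite ?invMg ?invg1 ?mulgV ?aV ?bV ?(expgS, expg0, mulg1, mul1g) -?mulgA;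
 do 12 (try rewrite ?(ba', ba, a4', b4', b4e) ?(expgS, expg0, mulg1, mul1g) -?mulgA) => //.
Qed.

Definition klein_m (R : comNzRingType) (a b c d : R) : R :=
  ((a + b) ^+ 2 - (c + d) ^+ 2) * ((a - b) ^+ 2 - (c - d) ^+ 2).

Definition klein_p (R : comNzRingType) (a b c d : R) : R :=
  ((a + b) ^+ 2 + (c + d) ^+ 2) * ((a - b) ^+ 2 + (c - d) ^+ 2).

Definition norm_m (R : comNzRingType) (a b c d : R) : R :=
  a ^+ 2 + b ^+ 2 - c ^+ 2 - d ^+ 2.

Definition norm_p (R : comNzRingType) (a b c d : R) : R :=
  a ^+ 2 + b ^+ 2 + c ^+ 2 + d ^+ 2.

(* In [theta p q r s], the entries 0, 1, 2, 3 of [p], [q], [r], [s] are the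
   Fourier coefficients of x on the cosets of Z(G) = {1, a^2, b^2, a^2 b^2}
   containing 1, a, b, ab, at the characters of Z(G) given by
   (a^2, b^2) = (1, 1), (1, -1), (-1, 1), (-1, -1); the four factors are F1 F2,
   F3 F4, D1^2 and D2^2. *)
Definition theta (R : comNzRingType) (p q r s : nat -> R) : R :=
  klein_m (p 0) (q 0) (r 0) (s 0) * klein_p (p 1) (q 1) (r 1) (s 1)
  * norm_m (p 2) (q 2) (r 2) (s 2) ^+ 2 * norm_p (p 3) (q 3) (r 3) (s 3) ^+ 2.

(** [c 0], ..., [c 3] are the values at 1, b^2, a^2, a^2 b^2 times a representative, in the order of
    the doubled enumeration. *)
Definition fourier (R : comNzRingType) (c : nat -> R) : nat -> R :=
  nth 0 [:: c 0 + c 1 + c 2 + c 3; c 0 - c 1 + c 2 - c 3;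
            c 0 + c 1 - c 2 - c 3; c 0 - c 1 - c 2 + c 3].

(** * Relations and an enumeration of the sixteen elements *)

Section Relations.
Variables (gT : finGroupType) (a b : gT).
Hypotheses (a4 : (a ^+ 4 = 1)%g) (ba : (b * a = a ^+ 3 * b)%g).

Lemma mul_b_expg_a n : (b * a ^+ n = a ^+ (3 * n) * b)%g.
Proof.
elim: n => [|n IH]; first by rewrite mulg1 mul1g.
by rewrite expgSr mulgA IH -mulgA ba mulgA -expgD mulnSr.
Qed.

Lemma commute_sqr_a_b : commute (a ^+ 2)%g b.
Proof.
by rewrite /commute mul_b_expg_a -[(3 * 2)%N]/(4 + 2)%N expgD a4 mul1g.
Qed.

Lemma commute_sqr_b_a : commute (b ^+ 2)%g a.
Proof.
rewrite /commute -[(b ^+ 2)%g]/(b * b)%g -mulgA ba mulgA mul_b_expg_a -mulgA.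
by rewrite -[(3 * 3)%N]/(4 * 2 + 1)%N expgD expgM a4 expg1n mul1g.
Qed.

End Relations.

Section Presentation.
Variables (gT : finGroupType) (G : {group gT}).
Hypothesis isoG :
  (G \isog Grp (g1 : g2 : g1 ^+ 4 = g2 ^+ 4 = 1, g2 * g1 = g1 ^+ 3 * g2))%g.

(** The sixteen products cover [G], whose order is at least 16, so they are distinct. *)
Lemma presentation_enum : exists a b : gT,
  let z := (a ^+ 2)%g in let w := (b ^+ 2)%g in
  let h := double_enum z (double_enum w (tnth [tuple 1%g; a; b; (a * b)%g])) in
  [/\ (a ^+ 4 = 1)%g, (b ^+ 4 = 1)%g, (b * a = a ^+ 3 * b)%g,
      injective h & #|G| = 16%N /\ forall i, h i \in G].
Proof.
have oG := order_ge16 isoG.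
have /existsP[[a b] /=] := isoGrp_hom isoG.
rewrite !xpair_eqE /= => /and4P[/eqP defG /eqP a4 /eqP b4 /eqP ba].
exists a, b; pose z := (a ^+ 2)%g; pose w := (b ^+ 2)%g.
pose h := double_enum z (double_enum w (tnth [tuple 1%g; a; b; (a * b)%g])).
rewrite /= -/z -/w -/h.
have [Ga Gb] : a \in G /\ b \in G.
  by rewrite -defG -!cycle_subG joing_subl joing_subr.
have Gh i : h i \in G.
  rewrite /h /double_enum; case: (split i) => i'; case: (split i') => j;
    by rewrite ?groupM ?groupX // (tnth_nth 1%g);
      case: j => [[|[|[|[|//]]]] ?] /=; rewrite ?groupM.
(* As [b] normalizes [<[a]>], every element of [G] is a power of [a] times a power of [b]. *)
have nab : b \in 'N(<[a]>)%g.
  by rewrite -groupV -cycle_subG norms_cycle conjgE invgK mulgA ba mulgK mem_cycle.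
have cwa : commute w a := commute_sqr_b_a a4 ba.
have surj : G \subset [set h i | i : 'I_(4 + 4 + (4 + 4))]%SET.
  rewrite -{1}defG norm_joinEr ?cycle_subG //; apply/fintype.subsetP => g.
  case/mulsgP => _ _ /cycleP[i ->] /cycleP[j ->] ->.
  rewrite (divn_eq i 4) (divn_eq j 4) !expgD !(mulnC _ 4) !expgM a4 b4 !expg1n !mul1g.
  have : (i %% 4 < 4)%N && (j %% 4 < 4)%N by rewrite !ltn_pmod.
  move: (i %% 4)%N (j %% 4)%N => {}i {}j /andP[lti ltj].
  (* An exponent [i < 4] is [odd i] plus twice [1 < i]; the even part goes into the central
     factor. *)
  have -> : (a ^+ i * b ^+ j = z ^+ (1 < i) * (w ^+ (1 < j) * (a ^+ odd i * b ^+ odd j)))%g.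
    have -> : (w ^+ (1 < j) * (a ^+ odd i * b ^+ odd j) = a ^+ odd i * (w ^+ (1 < j) * b ^+ odd j))%g.
      by rewrite !mulgA (commuteX2 _ _ cwa).
    rewrite -!expgM -!expgD mulgA -expgD.
    by case: i lti => [|[|[|[|]]]] //; case: j ltj => [|[|[|[|]]]].
  pose k : 'I_4 := inord (odd i + (odd j).*2).
  pose k1 := if (1 < j)%N then rshift 4 k else lshift 4 k.
  apply/imsetP; exists (if (1 < i)%N then rshift 8 k1 else lshift 8 k1) => //.
  have -> : (a ^+ odd i * b ^+ odd j)%g = tnth [tuple 1%g; a; b; (a * b)%g] k.
    rewrite (tnth_nth 1%g) inordK; last by case: (odd i) (odd j) => [] [].
    by case: (odd i) (odd j) => [] [] /=; rewrite ?mulg1 ?mul1g.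
  by rewrite /k1; case: (1 < i)%N (1 < j)%N => [] [];
    rewrite /h ?double_enum_rshift ?double_enum_lshift
      ?double_enum_rshift ?double_enum_lshift /= ?mul1g.
have oG16 : #|G| = 16%N.
  apply/eqP; rewrite eqn_leq oG andbT -[16%N]card_ord.
  exact: leq_trans (subset_leq_card surj) (leq_imset_card _ _).
have /imset_injP injh : #|[set h i | i : 'I_(4 + 4 + (4 + 4))]%SET| == #|'I_16|.
  by rewrite eqn_leq leq_imset_card /= card_ord -{1}oG16 subset_leq_card.
by split => // i j; apply: injh.
Qed.

(** The enumeration is chosen before [x], so that [x] can later be built from prescribed
    coefficients. *)
Lemma group_det_theta : exists2 h : 'I_16 -> gT, injective h &
  forall (R : comNzRingType) (x : gT -> R),
    let c k j := x (h (inord (4 * j + k))) in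
    group_det G x = theta (fourier (c 0)) (fourier (c 1)) (fourier (c 2)) (fourier (c 3)).
Proof.
have [a [b [a4 b4 ba injh [oG Gh]]]] := presentation_enum.
pose h0 := tnth [tuple 1%g; a; b; (a * b)%g].
pose z := (a ^+ 2)%g; pose w := (b ^+ 2)%g.
pose h := double_enum z (double_enum w h0).
exists h => // R x c; rewrite (group_det_diff_mx x (oG : #|G| = 4 + 4 + (4 + 4))%N injh Gh).
have zz : (z * z = 1)%g by rewrite -expgD.
have ww : (w * w = 1)%g by rewrite -expgD.
have cza : commute z a by apply/commute_sym/commuteX/commute_refl.
have cwb : commute w b by apply/commute_sym/commuteX/commute_refl.
have czb : commute z b := commute_sqr_a_b a4 ba.
have cwa : commute w a := commute_sqr_b_a a4 ba.
have ch0 v k : commute v a -> commute v b -> commute v (h0 k).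
  move=> ca cb; rewrite /h0 (tnth_nth 1%g).
  case: k => [[|[|[|[|//]]]] ?] /=; by [exact/commute1| | |exact: commuteM].
have czw : commute z w by apply: commuteX.
have zK g : (z * (z * g) = g)%g by rewrite mulgA zz mul1g.
have wK g : (w * (w * g) = g)%g by rewrite mulgA ww mul1g.
have wz g : (w * (z * g) = z * (w * g))%g by rewrite mulgA -czw -mulgA.
pose e := nth 1%g [:: 1%g; a; b; (a * b)%g].
have cE k : (k < 4)%N ->
    [/\ c k 0 = x (e k), c k 1 = x (w * e k)%g, c k 2 = x (z * e k)%g &
        c k 3 = x (z * (w * e k))%g].
  move=> ltk; have -> : e k = h0 (Ordinal ltk) by rewrite /h0 (tnth_nth 1%g).
  have E (i : 'I_(4 + 4 + (4 + 4))) j : (4 * j + k)%N = i -> c k j = x (h i).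
    by rewrite /c => ->; rewrite inord_val.
  split.
  - by rewrite (E (lshift 8 (lshift 4 (Ordinal ltk)))) // /h !double_enum_lshift.
  - rewrite (E (lshift 8 (rshift 4 (Ordinal ltk)))) //.
    by rewrite /h double_enum_lshift double_enum_rshift.
  - rewrite (E (rshift 8 (lshift 4 (Ordinal ltk)))) //.
    by rewrite /h double_enum_rshift double_enum_lshift.
  - by rewrite (E (rshift 8 (rshift 4 (Ordinal ltk)))) // /h !double_enum_rshift.
have cz k : commute z (h0 k) by apply: ch0.
have cw k : commute w (h0 k) by apply: ch0.
have czd k : commute z (double_enum w h0 k).
  rewrite /double_enum; case: (split k) => k'; first exact: cz.
  exact: commuteM.
(* Splitting along a^2 and then along b^2 produces the four sign characters. *)
rewrite -/z -/w -/h0 (det_diff_mx_double _ zz czd) !(det_diff_mx_double _ ww cw).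
rewrite (det_diff_mx_central (s := 1) (t := 1) a4 b4 ba); first last.
- by move=> g; rewrite -/w !wK; ring.
- by move=> g; rewrite -/z !wz !zK; ring.
rewrite (det_diff_mx_central (s := 1) (t := -1) a4 b4 ba); first last.
- by move=> g; rewrite -/w !wK; ring.
- by move=> g; rewrite -/z !wz !zK; ring.
rewrite (det_diff_mx_central (s := -1) (t := 1) a4 b4 ba); first last.
- by move=> g; rewrite -/w !wK; ring.
- by move=> g; rewrite -/z !wz !zK; ring.
rewrite (det_diff_mx_central (s := -1) (t := -1) a4 b4 ba); first last.
- by move=> g; rewrite -/w !wK; ring.
- by move=> g; rewrite -/z !wz !zK; ring.
have [c00 c01 c02 c03] := cE 0%N isT.
have [c10 c11 c12 c13] := cE 1%N isT.
have [c20 c21 c22 c23] := cE 2%N isT.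
have [c30 c31 c32 c33] := cE 3%N isT.
rewrite /theta /klein_m /klein_p /norm_m /norm_p /fourier.
rewrite c00 c01 c02 c03 c10 c11 c12 c13 c20 c21 c22 c23 c30 c31 c32 c33 /=.
rewrite mulrA; congr (_ * _ * _ * _).
- rewrite det_twisted_klein; congr (_ * _); congr (_ ^+ 2 - _ ^+ 2); ring.
- rewrite det_twisted_klein; congr (_ * _); congr (_ ^+ 2 + _ ^+ 2); ring.
- rewrite det_twisted_klein; congr ((_ ^+ 2 + _ ^+ 2 - _ ^+ 2 - _ ^+ 2) ^+ 2); ring.
- rewrite det_twisted_klein; congr ((_ ^+ 2 + _ ^+ 2 + _ ^+ 2 + _ ^+ 2) ^+ 2); ring.
Qed.
End Presentation.

(** * Sums of two and four squares *)

(** Used contrapositively: a number not 1 modulo [m] has a prime factor not 1 modulo [m]. *)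
Lemma eqn1_mod_of_primes m n : (0 < n)%N ->
  (forall p, prime p -> p %| n -> p = 1 %[mod m])%N -> (n = 1 %[mod m])%N.
Proof.
elim/ltn_ind: n => n IH n_gt0 Pn.
have [->//|n_neq1] := eqVneq n 1%N.
have n_gt1 : (1 < n)%N by lia.
have pr := pdiv_prime n_gt1; have dv := pdiv_dvd n.
rewrite -(divnK dv) -modnMm (Pn _ pr dv) modnMm muln1.
apply: IH => [||q prq dq].
- by rewrite ltn_Pdiv // prime_gt1.
- by rewrite divn_gt0 ?pdiv_gt0 // dvdn_leq.
- by apply: Pn => //; apply: dvdn_trans dq (dvdn_div dv).
Qed.

Lemma prime_factor_3mod4 n : (n %% 4 = 3)%N ->
  exists q, [/\ prime q, (q %% 4 = 3)%N & (q %| n)%N].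
Proof.
move=> n3; have n_gt0 : (0 < n)%N by lia.
have [/hasP[q]|/hasPn H] := boolP (has (fun q => q %% 4 == 3)%N (primes n)).
  by rewrite mem_primes => /and3P[pr _ dv] /eqP q3; exists q.
suff : (n = 1 %[mod 4])%N by lia.
apply: eqn1_mod_of_primes => // p pr dv.
have : (p %% 4 != 3)%N by apply: H; rewrite mem_primes pr n_gt0.
have [p2|] := even_prime pr; first by move: dv; rewrite p2; lia.
lia.
Qed.

(** By Fermat a^2 = a^(p+1) = (a^2)^((p+1)/2), an even power, so a^2 = -b^2 implies a^2 = b^2 and 2
    a^2 = 0. *)
Lemma Fp_sum_squares_eq0 p (a b : 'F_p) : prime p -> (p %% 4 = 3)%N ->
  a ^+ 2 + b ^+ 2 = 0 -> a = 0.
Proof.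
move=> pr p3 /eqP; rewrite addr_eq0 => /eqP ab.
have frob (x : 'F_p) : x ^+ p = x by have := expf_card x; rewrite card_Fp.
have ev : p.+1 = (2 * (2 * (p.+1 %/ 4)))%N by lia.
have a2 : a ^+ 2 = b ^+ 2.
  rewrite -[LHS]/(a * a) -[RHS]/(b * b) -{1}(frob a) -{1}(frob b) -!exprSr ev !exprM ab.
  by rewrite sqrrN.
move: ab; rewrite -a2 => /eqP; rewrite -addr_eq0 -mulr2n -mulr_natl mulf_eq0.
rewrite sqrf_eq0 => /orP[|/eqP//].
rewrite -(dvdn_pcharf (pchar_Fp pr)) => /dvdn_leq; lia.
Qed.

Lemma coprime_sum_squares_prime_factor p a b : prime p -> (p %% 4 = 3)%N ->
  coprime a b -> ~~ (p %| a ^ 2 + b ^ 2)%N.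
Proof.
move=> pr p3 cab; apply/negP => dv.
have E : ((a%:R : 'F_p) ^+ 2 + b%:R ^+ 2 = 0).
  by apply/eqP; rewrite -!natrX -natrD -(dvdn_pcharf (pchar_Fp pr)).
have da : (p %| a)%N.
  by rewrite (dvdn_pcharf (pchar_Fp pr)); apply/eqP; apply: Fp_sum_squares_eq0 E.
have db : (p %| b)%N.
  rewrite (dvdn_pcharf (pchar_Fp pr)); apply/eqP.
  by move: E; rewrite addrC; apply: Fp_sum_squares_eq0.
have : (p %| gcdn a b)%N by rewrite dvdn_gcd da.
by rewrite (eqP cab) dvdn1 => /eqP p1; rewrite p1 in pr.
Qed.

(** Dividing by the gcd, which is odd, keeps the residue 5. The prime factors of the coprime sum are
    1 modulo 4, and they cannot all be 1 modulo 8. *)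
Lemma sum_squares_prime_factor_5mod8 a b : ((a ^ 2 + b ^ 2) %% 8 = 5)%N ->
  exists p, [/\ prime p, (p %% 8 = 5)%N & (p %| a ^ 2 + b ^ 2)%N].
Proof.
move=> n5; have g_gt0 : (0 < gcdn a b)%N by rewrite gcdn_gt0; case: (a) (b) n5 => [|?] [|?].
set g := gcdn a b in g_gt0.
have [a' ea] : exists a', (a = a' * g)%N by exists (a %/ g)%N; rewrite divnK ?dvdn_gcdl.
have [b' eb] : exists b', (b = b' * g)%N by exists (b %/ g)%N; rewrite divnK ?dvdn_gcdr.
have cab : coprime a' b'.
  by rewrite /coprime -(eqn_pmul2r g_gt0) muln_gcdl -ea -eb mul1n.
set n := (a' ^ 2 + b' ^ 2)%N.
have nE : (a ^ 2 + b ^ 2 = n * g ^ 2)%N by rewrite {1}ea {1}eb !expnMn -mulnDl.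
have sq8 : (g ^ 2 %% 8 = 1)%N.
  have og : (g %% 2 = 1)%N.
    by move: n5; rewrite nE !expnS expn0 muln1; have := modn2 g; case: (odd g) => //; lia.
  have [k ->] : exists k, (g = 2 * k + 1)%N by exists (g %/ 2)%N; lia.
  by have := bin2_sum k.+1; rewrite !expnS expn0 muln1; case: (odd k) (odd_double_half k); lia.
have n5' : (n %% 8 = 5)%N by move: n5; rewrite nE -modnMmr sq8 muln1.
have [/hasP[p]|/hasPn H] := boolP (has (fun p => p %% 8 == 5)%N (primes n)).
  rewrite mem_primes => /and3P[pr _ dv] /eqP p5.
  by exists p; split=> //; rewrite nE dvdn_mulr.
suff : (n = 1 %[mod 8])%N by lia.
apply: eqn1_mod_of_primes => [|p pr dv]; first by lia.
have p5 : (p %% 8 != 5)%N by apply: H; rewrite mem_primes pr dv; lia.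
have p3 : (p %% 4 != 3)%N.
  by apply: contraL dv => /eqP p3; apply: coprime_sum_squares_prime_factor.
have [p2|] := even_prime pr; first by move: dv; rewrite p2; lia.
lia.
Qed.

(** X^(2k) - 1 has at most 2k roots, fewer than the 4k nonzero elements; the [k]-th power of a
    nonzero non-root squares to -1. *)
Lemma Fp_sqrtN1 p : prime p -> (p %% 4 = 1)%N -> exists x : 'F_p, x ^+ 2 = -1.
Proof.
move=> pr p1; set k := (p %/ 4)%N.
have p_gt1 := prime_gt1 pr.
have k_gt0 : (0 < k)%N by rewrite /k; lia.
pose s := enum [pred x : 'F_p | x != 0].
pose P : {poly 'F_p} := 'X^(2 * k) - 1%:P.
have sP : size P = (2 * k).+1 by rewrite size_XnsubC // muln_gt0.
have ss : size s = p.-1 by rewrite -cardE cardC1 card_Fp.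
have [all_root|] := boolP (all (root P) s).
  have P0 : P != 0 by rewrite -size_poly_eq0 sP.
  have := max_poly_roots P0 all_root (enum_uniq _).
  by rewrite ss sP /k; lia.
case/allPn => x; rewrite mem_enum inE => x0.
rewrite rootE !hornerE => nx; exists (x ^+ k).
have xp : x ^+ (2 * k * 2) = 1.
  apply: (mulIf x0); rewrite -exprSr mul1r.
  have -> : (2 * k * 2).+1 = p by rewrite /k; lia.
  by have := expf_card x; rewrite card_Fp.
move: xp; rewrite exprM => /eqP; rewrite sqrf_eq1 => /orP[]/eqP.
  by move=> e; rewrite e subrr eqxx in nx.
by rewrite -exprM mulnC.
Qed.

Lemma nat_sqrt n : exists k, (k ^ 2 <= n < k.+1 ^ 2)%N.
Proof.
elim: n => [|n [k /andP[le lt]]]; first by exists 0%N.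
have [lt'|ge] := ltnP n.+1 (k.+1 ^ 2); [exists k|exists k.+1]; apply/andP; split=> //.
  exact: leq_trans le _.
by apply: leq_ltn_trans lt _; rewrite ltn_exp2r.
Qed.

(** Thue's pigeonhole argument: two of the [k.+1 ^ 2 > p] pairs collide, and their differences
    satisfy 0 < a^2 + b^2 < 2p with [p] dividing the sum. *)
Lemma prime_sum_two_squares p : prime p -> (p %% 4 = 1)%N ->
  exists a b : int, a ^+ 2 + b ^+ 2 = p%:Z.
Proof.
move=> pr p1; have [x x2] := Fp_sqrtN1 pr p1.
have [k /andP[le lt]] := nat_sqrt p.
pose f (u : 'I_k.+1 * 'I_k.+1) : 'F_p := u.1%:R + x * u.2%:R.
have /injectivePn[u [v neq fuv]] : ~~ injectiveb f.
  apply/injectiveP => /leq_card; rewrite card_prod !card_ord (Fp_cast pr).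
  by move: lt; rewrite expnS expn1; lia.
pose a : int := u.1%:Z - v.1%:Z; pose b : int := u.2%:Z - v.2%:Z.
have dv : (p%:Z %| a ^+ 2 + b ^+ 2)%Z.
  rewrite (dvdz_pcharf (pchar_Fp pr)) rmorphD !rmorphXn /=.
  have -> : a%:~R = - x * b%:~R :> 'F_p.
    apply/eqP; rewrite -subr_eq0; apply/eqP.
    have -> : a%:~R - - x * b%:~R = f u - f v by rewrite /f /a /b !rmorphB /=; ring.
    by rewrite fuv subrr.
  by rewrite mulNr sqrrN exprMn x2 mulN1r addNr.
have kp : (k ^ 2 != p)%N.
  apply/eqP => e; have /primeP[p_gt1 /(_ k)] := pr.
  have -> : (k %| p)%N by rewrite -e expnS dvdn_mulr.
  by move=> /(_ isT) /orP[] /eqP kE; move: e p_gt1; rewrite kE expnS expn1; nia.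
have [t et] := dvdzP dv.
have pos : 0 < a ^+ 2 + b ^+ 2.
  rewrite lt_neqAle addr_ge0 ?sqr_ge0 // andbT eq_sym paddr_eq0 ?sqr_ge0 // !sqrf_eq0.
  apply: contra neq => /andP[/eqP a0 /eqP b0]; apply/eqP.
  rewrite [u]surjective_pairing [v]surjective_pairing; move: a0 b0; rewrite /a /b => a0 b0.
  by congr (_, _); apply/ord_inj; lia.
have ub (i j : 'I_k.+1) : (i%:Z - j%:Z) ^+ 2 <= k%:Z ^+ 2.
  have := ltn_ord i; have := ltn_ord j; nia.
have := ub u.1 v.1; have := ub u.2 v.2; rewrite -/a -/b => ba bb.
exists a, b; rewrite et.
have kp' : k%:Z ^+ 2 < p%:Z by move: le kp; rewrite expnS expn1; lia.
have p_gt0 : 0 < p%:Z by have := prime_gt0 pr; lia.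
have -> : t = 1 by nia.
by rewrite mul1r.
Qed.

(** * Lagrange's four-square theorem *)

Definition sum4 (n : int) := exists a b c d : int, n = a ^+ 2 + b ^+ 2 + c ^+ 2 + d ^+ 2.

(** Euler's identity, the multiplicativity of the quaternion norm. *)
Lemma sum4M m n : sum4 m -> sum4 n -> sum4 (m * n).
Proof.
move=> [a [b [c [d ->]]]] [x [y [z [t ->]]]].
exists (a * x + b * y + c * z + d * t), (a * y - b * x + c * t - d * z),
  (a * z - c * x + d * y - b * t), (a * t - d * x + b * z - c * y); ring.
Qed.

Lemma balanced_residue (m x : int) : 0 < m ->
  exists y k, x = y + m * k /\ 4 * y ^+ 2 <= m ^+ 2.
Proof.
move=> m0; have := divz_eq x m; have := modz_ge0 x (lt0r_neq0 m0); have := ltz_pmod x m0.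
set r := (x %% m)%Z; set q := (x %/ m)%Z => h1 h2 ->.
have [h|h] := lerP (2 * r) m; [exists r, q|exists (r - m), (q + 1)]; split; [ring|nia|ring|nia].
Qed.

(** Lagrange's descent: balanced residues of the four roots modulo [m] have squares summing to
    [m * r], and [r] replaces [m]. *)
Lemma sum4_descent (p : nat) (m : int) : prime p -> 0 < m < p%:Z -> sum4 (m * p%:Z) -> sum4 p.
Proof.
move=> pr; have [n] := ubnP `|m|%N; elim: n m => // n IH m lt_mn /andP[m0 mp].
have [->|m1] := eqVneq m 1; first by rewrite mul1r.
move=> [x1 [x2 [x3 [x4 ex]]]].
have [y1 [k1 [e1 b1]]] := balanced_residue x1 m0.
have [y2 [k2 [e2 b2]]] := balanced_residue x2 m0.
have [y3 [k3 [e3 b3]]] := balanced_residue x3 m0.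
have [y4 [k4 [e4 b4]]] := balanced_residue x4 m0.
(* This is the quotient by [m] of the sum of the squared residues, written without division. *)
pose r := p%:Z - 2 * (y1 * k1 + y2 * k2 + y3 * k3 + y4 * k4)
  - m * (k1 ^+ 2 + k2 ^+ 2 + k3 ^+ 2 + k4 ^+ 2).
have mr : m * r = y1 ^+ 2 + y2 ^+ 2 + y3 ^+ 2 + y4 ^+ 2.
  rewrite /r !mulrBr ex e1 e2 e3 e4; ring.
(* As 1 < m < p, [m] does not divide [p]; this excludes the extremes [r = 0] and [r = m]. *)
have ndv (t : int) : p%:Z != m * t.
  apply/eqP => e; have /primeP[_ /(_ `|m|%N)] := pr.
  have -> : (`|m| %| p)%N by apply/dvdnP; exists `|t|%N; rewrite -[p]/`|p%:Z|%N e abszM mulnC.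
  by move=> /(_ isT) /orP[] /eqP; move: m0 mp m1; clear; lia.
have r_ge0 : 0 <= r.
  by rewrite -(pmulr_rge0 _ m0) mr !addr_ge0 ?sqr_ge0.
have r_le : r <= m.
  by rewrite -(ler_pM2l m0) mr; move: b1 b2 b3 b4; clear; lia.
have [r0|r_neq0] := eqVneq r 0.
  have [y10 y20 y30 y40] : [/\ y1 = 0, y2 = 0, y3 = 0 & y4 = 0].
    have sq0 (y : int) : y ^+ 2 = 0 -> y = 0 by move/eqP; rewrite sqrf_eq0 => /eqP.
    move: mr (sqr_ge0 y1) (sqr_ge0 y2) (sqr_ge0 y3) (sqr_ge0 y4); rewrite r0 mulr0.
    by clear -sq0 => *; split; apply: sq0; lia.
  have := ndv (k1 ^+ 2 + k2 ^+ 2 + k3 ^+ 2 + k4 ^+ 2).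
  by rewrite -subr_eq0 -r0 /r y10 y20 y30 y40 => /eqP[]; ring.
have [rm|r_neqm] := eqVneq r m.
  have half y k : 4 * y ^+ 2 = m ^+ 2 -> exists s, 2 * (y * k) = m * s.
    move=> e; have /eqP : (2 * y) ^+ 2 = m ^+ 2 by rewrite -e; ring.
    by rewrite eqf_sqr => /orP[]/eqP h; [exists k|exists (- k)]; rewrite mulrA h; ring.
  have E : [/\ 4 * y1 ^+ 2 = m ^+ 2, 4 * y2 ^+ 2 = m ^+ 2, 4 * y3 ^+ 2 = m ^+ 2 &
      4 * y4 ^+ 2 = m ^+ 2].
    by move: mr b1 b2 b3 b4; rewrite rm; clear; split; lia.
  have [/(half _ k1)[s1 h1] /(half _ k2)[s2 h2] /(half _ k3)[s3 h3] /(half _ k4)[s4 h4]] := E.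
  have := ndv (1 + (s1 + s2 + s3 + s4) + (k1 ^+ 2 + k2 ^+ 2 + k3 ^+ 2 + k4 ^+ 2)).
  by move: rm h1 h2 h3 h4; rewrite /r; clear => rm h1 h2 h3 h4 /eqP[]; lia.
have r_bnd : 0 < r < m by move: r_ge0 r_le r_neq0 r_neqm; clear; lia.
apply: (IH r); [by move: r_bnd lt_mn; clear; lia|by move: r_bnd mp; clear; lia|].
(* Euler's product of the roots and their residues, each coordinate divided by [m]. *)
exists (r + (k1 * y1 + k2 * y2 + k3 * y3 + k4 * y4)),
  (k1 * y2 - k2 * y1 + k3 * y4 - k4 * y3), (k1 * y3 - k3 * y1 + k4 * y2 - k2 * y4),
  (k1 * y4 - k4 * y1 + k2 * y3 - k3 * y2).
have m2 : m ^+ 2 != 0 by rewrite sqrf_eq0 gt_eqF.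
apply: (mulfI m2).
have -> : m ^+ 2 * (r * p) = (m * r) * (m * p%:Z) by ring.
have dist (A B C D : int) : m ^+ 2 * ((r + A) ^+ 2 + B ^+ 2 + C ^+ 2 + D ^+ 2)
  = (m * r + m * A) ^+ 2 + m ^+ 2 * (B ^+ 2 + C ^+ 2 + D ^+ 2) by ring.
by rewrite [X in _ * X]ex dist mr e1 e2 e3 e4; ring.
Qed.

(** The [h.+1] values i^2 and the [h.+1] values -1 - j^2 are [p + 1] in number, so one of each kind
    agree; [i, j <= h] keeps the multiplier below [p]. *)
Lemma sum4_prime_multiple p : prime p -> odd p ->
  exists2 m : int, 0 < m < p%:Z & sum4 (m * p%:Z).
Proof.
move=> pr op; set h := p./2.
have hE : p = (2 * h + 1)%N by rewrite /h -[LHS]odd_double_half op -mul2n addnC.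
pose f (u : 'I_h.+1 + 'I_h.+1) : 'F_p :=
  match u with inl i => i%:R ^+ 2 | inr j => - 1 - j%:R ^+ 2 end.
have injsq (i j : 'I_h.+1) : (i%:R ^+ 2 : 'F_p) = j%:R ^+ 2 -> i = j.
  wlog le_ij : i j / (i <= j)%N.
    by move=> W; have [/W//|/ltnW /W V /esym /V ->] := leqP i j.
  move/eqP; rewrite eq_sym -subr_eq0 subr_sqr mulf_eq0 -natrB // -natrD.
  rewrite -!(dvdn_pcharf (pchar_Fp pr)) => dv; apply/ord_inj.
  have := ltn_ord i; have := ltn_ord j.
  by case/orP: dv => /dvdnP[t]; case: t => [|t]; nia.
have /injectivePn[u [v neq fuv]] : ~~ injectiveb f.
  by apply/injectiveP => /leq_card; rewrite card_sum !card_ord (Fp_cast pr); lia.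
have [i [j eij]] : exists i j : 'I_h.+1, i%:R ^+ 2 = - 1 - j%:R ^+ 2 :> 'F_p.
  case: u v neq fuv => i [] j /= neq e; last 1 first.
  - by move: neq; rewrite (injsq i j) ?eqxx //; apply: oppr_inj; apply: addrI e.
  - by move: neq; rewrite (injsq i j e) eqxx.
  - by exists i, j.
  - by exists j, i.
have : (p %| i ^ 2 + j ^ 2 + 1)%N.
  rewrite (dvdn_pcharf (pchar_Fp pr)) !natrD !natrX eij; apply/eqP; ring.
have := ltn_ord i; have := ltn_ord j => lti ltj /dvdnP[t et].
exists t%:Z.
  have hi : (i * i <= h * h)%N by apply: leq_mul.
  have hj : (j * j <= h * h)%N by apply: leq_mul.
  have p_gt1 := prime_gt1 pr.
  have t_gt0 : (0 < t)%N by case: (t) et => //; lia.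
  suff : (t < p)%N by move: t_gt0; clear; lia.
  rewrite -(ltn_pmul2r (prime_gt0 pr)) -et.
  by move: hi hj hE p_gt1; rewrite !expnS expn0 !muln1; clear; nia.
exists i%:Z, j%:Z, 1, 0; rewrite -PoszM -et; lia.
Qed.

Theorem lagrange_four_squares (n : nat) : sum4 n%:Z.
Proof.
elim/ltn_ind: n => n IH.
have [->|n0] := eqVneq n 0%N; first by exists 0, 0, 0, 0.
have [->|n1] := eqVneq n 1%N; first by exists 1, 0, 0, 0.
have n_gt1 : (1 < n)%N by lia.
have pr := pdiv_prime n_gt1.
have sp : sum4 (pdiv n)%:Z.
  have [->|op] := even_prime pr; first by exists 1, 1, 0, 0.
  by have [m m_bnd sm] := sum4_prime_multiple pr op; apply: sum4_descent m_bnd sm.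
rewrite -(divnK (pdiv_dvd n)) PoszM; apply: sum4M => //.
by apply: IH; rewrite ltn_Pdiv ?prime_gt1 //; lia.
Qed.

(** * Values of the determinant *)

Definition spectrum (v : nat -> int) := exists i j k m : int,
  [/\ v 1%N = v 0%N + 2 * i, v 2%N = v 0%N + 2 * j, v 3%N = v 0%N + 2 * k
    & v 0%N + v 1%N + v 2%N + v 3%N = 4 * m].

Lemma fourier_spectrum (c : nat -> int) : spectrum (fourier c).
Proof.
exists (- c 1%N - c 3%N), (- c 2%N - c 3%N), (- c 1%N - c 2%N), (c 0%N).
by rewrite /fourier /=; split; ring.
Qed.

Lemma spectrum_fourier v : spectrum v -> exists c : nat -> int,
  [/\ fourier c 0 = v 0, fourier c 1 = v 1, fourier c 2 = v 2 & fourier c 3 = v 3]%N.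
Proof.
move=> [i [j [k [m [e1 e2 e3 e4]]]]].
(* Fourier inversion: [m] is the mean of the four values, and [v 0 + j] is the half-sum of [v 0] and
   [v 2]. *)
exists (nth 0 [:: m; v 0%N + j - m; v 0%N + i - m; v 0%N + k - m]).
by rewrite /fourier /=; split; lia.
Qed.

Definition theta_value (n : int) := exists p q r s,
  [/\ spectrum p, spectrum q, spectrum r, spectrum s & n = theta p q r s].

Section Values.
Variables (gT : finGroupType) (G : {group gT}).
Hypothesis isoG :
  (G \isog Grp (g1 : g2 : g1 ^+ 4 = g2 ^+ 4 = 1, g2 * g1 = g1 ^+ 3 * g2))%g.

Lemma int_group_detsP (n : int) : int_group_dets G n <-> theta_value n.
Proof.
have [h injh thetaE] := group_det_theta isoG; split=> [[x _ <-]|].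
  rewrite thetaE; do 4 eexists; split; last reflexivity; exact: fourier_spectrum.
move=> [p [q [r [s [/spectrum_fourier[c0 [e00 e01 e02 e03]]
  /spectrum_fourier[c1 [e10 e11 e12 e13]] /spectrum_fourier[c2 [e20 e21 e22 e23]]
  /spectrum_fourier[c3 [e30 e31 e32 e33]] ->]]]]].
pose c := nth c0 [:: c0; c1; c2; c3].
(* Index [4 * j + k] is decoded into coset [k] and position [j]; off the enumeration [x] is 0. *)
pose x g : int := if [pick i | h i == g] is Some i then c (i %% 4)%N (i %/ 4)%N else 0.
exists x => //; rewrite thetaE.
have cE k j : (k < 4)%N -> (j < 4)%N -> x (h (inord (4 * j + k))) = c k j.
  move=> ltk ltj; rewrite /x.
  case: pickP => [i /eqP /injh ->|/(_ (inord (4 * j + k)))]; last by rewrite eqxx.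
  rewrite inordK; last by lia.
  by congr (c _ _); lia.
rewrite /theta.
rewrite -e00 -e01 -e02 -e03 -e10 -e11 -e12 -e13 -e20 -e21 -e22 -e23 -e30 -e31 -e32 -e33.
by rewrite /fourier !cE.
Qed.

End Values.

(** * Parities and residues of the factors *)

Lemma even_or_odd (a : int) : (exists m, a = 2 * m) \/ (exists m, a = 2 * m + 1).
Proof.
have [e|e] : a = 2 * (a %/ 2)%Z \/ a = 2 * (a %/ 2)%Z + 1 by lia.
- by left; exists (a %/ 2)%Z.
- by right; exists (a %/ 2)%Z.
Qed.

Lemma sqr_parity (a : int) : exists t, a ^+ 2 = a + 2 * t.
Proof.
have [[m ->]|[m ->]] := even_or_odd a; first by exists (2 * m ^+ 2 - m); ring.
by exists (2 * m ^+ 2 + m); ring.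
Qed.

Lemma sqr_odd (a : int) : exists t, (2 * a + 1) ^+ 2 = 8 * t + 1.
Proof. by have [t et] := sqr_parity a; exists (a + t); lia. Qed.

(** Turns an existential congruence into an equation with an explicit quotient, which [lia] can
    decide. *)
Lemma ex_quotient (n x y : int) : x = y + n * ((x - y) %/ n)%Z -> exists e, x = y + n * e.
Proof. by exists ((x - y) %/ n)%Z. Qed.

(** All four factors of [theta] obey this formula, so their product modulo 16 depends only on the
    parity of the total of the halves. *)
Lemma klein_m_mod16 (a b c d : int) : exists e,
  klein_m (2 * a + 1) (2 * b) (2 * c) (2 * d) = 1 + 8 * (b + c + d) + 16 * e.
Proof.
have [t et] := sqr_odd a; have [u eu] := sqr_parity b.
have [v ev] := sqr_parity c; have [w ew] := sqr_parity d.
apply: ex_quotient; have -> : klein_m (2 * a + 1) (2 * b) (2 * c) (2 * d) =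
  ((2 * a + 1) ^+ 2 - 4 * b ^+ 2) ^+ 2
  - 8 * ((2 * a + 1) ^+ 2 + 4 * b ^+ 2) * (c ^+ 2 + d ^+ 2)
  + 16 * (4 * (2 * a + 1) * b * c * d + (c ^+ 2 - d ^+ 2) ^+ 2)
  by rewrite /klein_m; ring.
rewrite et eu ev ew; clear; lia.
Qed.

Lemma klein_p_mod16 (a b c d : int) : exists e,
  klein_p (2 * a + 1) (2 * b) (2 * c) (2 * d) = 1 + 8 * (b + c + d) + 16 * e.
Proof.
have [t et] := sqr_odd a; have [u eu] := sqr_parity b.
have [v ev] := sqr_parity c; have [w ew] := sqr_parity d.
apply: ex_quotient.
have -> : klein_p (2 * a + 1) (2 * b) (2 * c) (2 * d) =
  ((2 * a + 1) ^+ 2 - 4 * b ^+ 2) ^+ 2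
  + 8 * ((2 * a + 1) ^+ 2 + 4 * b ^+ 2) * (c ^+ 2 + d ^+ 2)
  - 16 * (4 * (2 * a + 1) * b * c * d - (c ^+ 2 - d ^+ 2) ^+ 2)
  by rewrite /klein_p; ring.
rewrite et eu ev ew; clear; lia.
Qed.

Lemma sqr_norm_m_mod16 (a b c d : int) : exists e,
  norm_m (2 * a + 1) (2 * b) (2 * c) (2 * d) ^+ 2 = 1 + 8 * (b + c + d) + 16 * e.
Proof.
have [t et] := sqr_odd a; have [u eu] := sqr_parity b.
have [v ev] := sqr_parity c; have [w ew] := sqr_parity d.
by apply: ex_quotient; rewrite /norm_m et !exprMn eu ev ew; clear; lia.
Qed.

Lemma sqr_norm_p_mod16 (a b c d : int) : exists e,
  norm_p (2 * a + 1) (2 * b) (2 * c) (2 * d) ^+ 2 = 1 + 8 * (b + c + d) + 16 * e.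
Proof.
have [t et] := sqr_odd a; have [u eu] := sqr_parity b.
have [v ev] := sqr_parity c; have [w ew] := sqr_parity d.
by apply: ex_quotient; rewrite /norm_p et !exprMn eu ev ew; clear; lia.
Qed.

Lemma spectrum_even v a : spectrum v -> v 0%N = 2 * a -> exists a1 a2 a3 h,
  [/\ v 1%N = 2 * a1, v 2%N = 2 * a2, v 3%N = 2 * a3 & a + a1 + a2 + a3 = 2 * h].
Proof.
move=> [i [j [k [m [e1 e2 e3 e4]]]]] e0; exists (a + i), (a + j), (a + k), m.
by split; lia.
Qed.

Lemma spectrum_odd v a : spectrum v -> v 0%N = 2 * a + 1 -> exists a1 a2 a3,
  [/\ v 1%N = 2 * a1 + 1, v 2%N = 2 * a2 + 1 & v 3%N = 2 * a3 + 1].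
Proof.
move=> [i [j [k [m [e1 e2 e3 e4]]]]] e0; exists (a + i), (a + j), (a + k).
by split; lia.
Qed.

(** The halves of each even quadruple have an even sum, which cancels every term 8 modulo 16. *)
Lemma theta_odd_even_even_even p q r s a b c d :
  spectrum p -> spectrum q -> spectrum r -> spectrum s ->
  p 0%N = 2 * a + 1 -> q 0%N = 2 * b -> r 0%N = 2 * c -> s 0%N = 2 * d ->
  exists k, theta p q r s = 16 * k + 1.
Proof.
move=> sp sq sr ss p0 q0 r0 s0.
have [a1 [a2 [a3 [p1 p2 p3]]]] := spectrum_odd sp p0.
have [b1 [b2 [b3 [i [q1 q2 q3 eb]]]]] := spectrum_even sq q0.
have [c1 [c2 [c3 [j [r1 r2 r3 ec]]]]] := spectrum_even sr r0.
have [d1 [d2 [d3 [k [s1 s2 s3 ed]]]]] := spectrum_even ss s0.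
rewrite /theta p0 p1 p2 p3 q0 q1 q2 q3 r0 r1 r2 r3 s0 s1 s2 s3.
have [x ->] := klein_m_mod16 a b c d; have [y ->] := klein_p_mod16 a1 b1 c1 d1.
have [z ->] := sqr_norm_m_mod16 a2 b2 c2 d2; have [t ->] := sqr_norm_p_mod16 a3 b3 c3 d3.
have mul (u v e f : int) : exists g,
    (1 + 8 * u + 16 * e) * (1 + 8 * v + 16 * f) = 1 + 8 * (u + v) + 16 * g.
  by apply: ex_quotient; lia.
have [g ->] := mul (b + c + d) (b1 + c1 + d1) x y.
have [g' ->] := mul (b + c + d + (b1 + c1 + d1)) (b2 + c2 + d2) g z.
have [g'' ->] := mul (b + c + d + (b1 + c1 + d1) + (b2 + c2 + d2)) (b3 + c3 + d3) g' t.
exists (i + j + k + g''); lia.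
Qed.

Lemma sum_squares_5mod8_factor (a b x : int) : a ^+ 2 + b ^+ 2 = 8 * x + 5 ->
  exists p l f, [/\ prime p, p%:Z = 8 * l - 3 & a ^+ 2 + b ^+ 2 = p%:Z * f].
Proof.
move=> e.
have eN : a ^+ 2 + b ^+ 2 = (`|a| ^ 2 + `|b| ^ 2)%N%:Z.
  by rewrite PoszD -!abszX !abszE !ger0_norm ?sqr_ge0.
have [|p [pr p5 /dvdnP[f ef]]] := @sum_squares_prime_factor_5mod8 `|a|%N `|b|%N.
  by move: e; rewrite eN; lia.
exists p, (p %/ 8 + 1)%N%:Z, f%:Z; split=> //; first by lia.
by rewrite eN ef PoszM mulrC.
Qed.

(** Modulo 16 the product is 9 + 8 (k + l + m). *)
Lemma exceptional_or_1mod16 (k l m : int) (p : nat) : prime p -> p%:Z = 8 * l - 3 ->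
  1 <= m -> let n := (8 * k - 3) * (8 * l - 3) * (4 * m - 1) ^+ 2 in
  (exists j, n = 16 * j + 1) \/ odd_exceptional_dets n.
Proof.
move=> pr pl m1 n; have [e|e] := even_or_odd (k + l - m); last first.
  left; exists ((n - 1) %/ 16)%Z; rewrite /n; case: e => [t e].
  have -> : k = 2 * t + 1 + m - l by lia.
  by clear; lia.
right; exists k, l, m; split=> //; [by exists p => //; split=> //; lia|case: e => t; lia].
Qed.

(** Here F1 F2 is 5 modulo 8, D1^2 is 1 modulo 8, and D2 is positive and 3 modulo 4, being three odd
    squares plus an even one. *)
Lemma theta_odd_even_odd_odd p q r s a b c d :
  spectrum p -> spectrum q -> spectrum r -> spectrum s ->
  p 0%N = 2 * a + 1 -> q 0%N = 2 * b -> r 0%N = 2 * c + 1 -> s 0%N = 2 * d + 1 ->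
  (exists k, theta p q r s = 16 * k + 1) \/ odd_exceptional_dets (theta p q r s).
Proof.
move=> sp sq sr ss p0 q0 r0 s0.
have [a1 [a2 [a3 [p1 p2 p3]]]] := spectrum_odd sp p0.
have [b1 [b2 [b3 [i [q1 q2 q3 eb]]]]] := spectrum_even sq q0.
have [c1 [c2 [c3 [r1 r2 r3]]]] := spectrum_odd sr r0.
have [d1 [d2 [d3 [s1 s2 s3]]]] := spectrum_odd ss s0.
rewrite /theta p0 p1 p2 p3 q0 q1 q2 q3 r0 r1 r2 r3 s0 s1 s2 s3.
have [km ekm] : exists k, klein_m (2 * a + 1) (2 * b) (2 * c + 1) (2 * d + 1) = 5 + 8 * k.
  have [t et] := sqr_odd (a + b); have [u eu] := sqr_odd (a - b).
  have [v ev] := sqr_parity (c + d + 1); have [w ew] := sqr_parity (c - d).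
  apply: ex_quotient; have -> : klein_m (2 * a + 1) (2 * b) (2 * c + 1) (2 * d + 1) =
    ((2 * (a + b) + 1) ^+ 2 - 4 * (c + d + 1) ^+ 2)
    * ((2 * (a - b) + 1) ^+ 2 - 4 * (c - d) ^+ 2) by rewrite /klein_m; ring.
  by rewrite et eu ev ew; clear; lia.
have [nm enm] : exists k, norm_m (2 * a2 + 1) (2 * b2) (2 * c2 + 1) (2 * d2 + 1) ^+ 2 = 1 + 8 * k.
  have [t et] := sqr_odd a2; have [u eu] := sqr_odd c2; have [v ev] := sqr_odd d2.
  have [x ->] : exists x, norm_m (2 * a2 + 1) (2 * b2) (2 * c2 + 1) (2 * d2 + 1) = 2 * x + 1.
    exists (4 * t + 2 * b2 ^+ 2 - 4 * u - 4 * v - 1).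
    by rewrite /norm_m et eu ev; ring.
  by have [y ->] := sqr_odd x; exists y; ring.
have [m m1 enp] : exists2 m, 1 <= m & norm_p (2 * a3 + 1) (2 * b3) (2 * c3 + 1) (2 * d3 + 1) = 4 * m - 1.
  have [t et] := sqr_odd a3; have [u eu] := sqr_odd c3; have [v ev] := sqr_odd d3.
  have e : norm_p (2 * a3 + 1) (2 * b3) (2 * c3 + 1) (2 * d3 + 1)
    = 4 * (2 * t + 2 * u + 2 * v + b3 ^+ 2 + 1) - 1 by rewrite /norm_p et eu ev; ring.
  exists (2 * t + 2 * u + 2 * v + b3 ^+ 2 + 1) => //.
  have : 0 <= norm_p (2 * a3 + 1) (2 * b3) (2 * c3 + 1) (2 * d3 + 1).
    by rewrite !addr_ge0 ?sqr_ge0.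
  by rewrite e; clear; lia.
rewrite ekm enm enp.
have [x [y [z [t [ekp exy [u eu]]]]]] : exists x y z t : int,
    [/\ klein_p (2 * a1 + 1) (2 * b1) (2 * c1 + 1) (2 * d1 + 1) = (x ^+ 2 + y ^+ 2) * z,
     x ^+ 2 + y ^+ 2 = 8 * t + 5 & exists u, z = 8 * u + 1].
  have -> : klein_p (2 * a1 + 1) (2 * b1) (2 * c1 + 1) (2 * d1 + 1) =
    ((2 * (a1 + b1) + 1) ^+ 2 + (2 * (c1 + d1 + 1)) ^+ 2)
    * ((2 * (a1 - b1) + 1) ^+ 2 + (2 * (c1 - d1)) ^+ 2) by rewrite /klein_p; ring.
  have sq1 (v w : int) : exists t, (2 * v + 1) ^+ 2 + (2 * (2 * w)) ^+ 2 = 8 * t + 1.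
    by have [e ee] := sqr_odd v; exists (e + 2 * w ^+ 2); rewrite ee; ring.
  have sq5 (v w : int) : exists t, (2 * v + 1) ^+ 2 + (2 * (2 * w + 1)) ^+ 2 = 8 * t + 5.
    have [e ee] := sqr_odd v; have [f ef] := sqr_odd w.
    by exists (e + 4 * f); rewrite ee [(2 * (2 * w + 1)) ^+ 2]exprMn ef; ring.
  (* [c1 + d1 + 1] and [c1 - d1] have opposite parities, so exactly one of the two sums of squares
     is 5 modulo 8. *)
  have [[g eg]|[g eg]] := even_or_odd (c1 + d1 + 1).
    rewrite eg; have -> : c1 - d1 = 2 * (g - d1 - 1) + 1 by lia.
    have [f ef] := sq5 (a1 - b1) (g - d1 - 1).
    exists (2 * (a1 - b1) + 1), (2 * (2 * (g - d1 - 1) + 1)),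
      ((2 * (a1 + b1) + 1) ^+ 2 + (2 * (2 * g)) ^+ 2), f.
    by split; [rewrite mulrC|exact: ef|exact: sq1].
  rewrite eg; have -> : c1 - d1 = 2 * (g - d1) by lia.
  have [f ef] := sq5 (a1 + b1) g.
  exists (2 * (a1 + b1) + 1), (2 * (2 * g + 1)),
    ((2 * (a1 - b1) + 1) ^+ 2 + (2 * (2 * (g - d1))) ^+ 2), f.
  by split; [ |exact: ef|exact: sq1].
have [p' [l [f [pr pl ef]]]] := sum_squares_5mod8_factor exy.
have [g eg] : exists g, f = 1 + 8 * g.
  apply: ex_quotient; move: exy; rewrite ef pl; clear; lia.
(* Everything except the prime and D2^2 is gathered into one factor. *)
have [k ek] : exists k, (5 + 8 * km) * f * z * (1 + 8 * nm) = - 3 + 8 * k.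
  by apply: ex_quotient; rewrite eg eu; clear; lia.
have -> : (5 + 8 * km) * klein_p (2 * a1 + 1) (2 * b1) (2 * c1 + 1) (2 * d1 + 1) * (1 + 8 * nm)
    * (4 * m - 1) ^+ 2 = (8 * k - 3) * (8 * l - 3) * (4 * m - 1) ^+ 2.
  have -> : 8 * k - 3 = (5 + 8 * km) * f * z * (1 + 8 * nm) by rewrite ek addrC.
  by rewrite ekp ef pl; ring.
exact: exceptional_or_1mod16 pr pl m1.
Qed.

(** The factors contribute 4 + 4 + 4 + 4 powers of 2. *)
Lemma theta_all_even p q r s a b c d :
  spectrum p -> spectrum q -> spectrum r -> spectrum s ->
  p 0%N = 2 * a -> q 0%N = 2 * b -> r 0%N = 2 * c -> s 0%N = 2 * d ->
  exists k, theta p q r s = 2 ^+ 15 * k.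
Proof.
move=> sp sq sr ss p0 q0 r0 s0.
have [a1 [a2 [a3 [_ [p1 p2 p3 _]]]]] := spectrum_even sp p0.
have [b1 [b2 [b3 [_ [q1 q2 q3 _]]]]] := spectrum_even sq q0.
have [c1 [c2 [c3 [_ [r1 r2 r3 _]]]]] := spectrum_even sr r0.
have [d1 [d2 [d3 [_ [s1 s2 s3 _]]]]] := spectrum_even ss s0.
rewrite /theta p0 p1 p2 p3 q0 q1 q2 q3 r0 r1 r2 r3 s0 s1 s2 s3.
have -> : klein_m (2 * a) (2 * b) (2 * c) (2 * d) = 16 * klein_m a b c d by rewrite /klein_m; ring.
have -> : klein_p (2 * a1) (2 * b1) (2 * c1) (2 * d1) = 16 * klein_p a1 b1 c1 d1 by rewrite /klein_p; ring.
have -> : norm_m (2 * a2) (2 * b2) (2 * c2) (2 * d2) = 4 * norm_m a2 b2 c2 d2 by rewrite /norm_m; ring.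
have -> : norm_p (2 * a3) (2 * b3) (2 * c3) (2 * d3) = 4 * norm_p a3 b3 c3 d3 by rewrite /norm_p; ring.
exists (2 * klein_m a b c d * klein_p a1 b1 c1 d1
  * norm_m a2 b2 c2 d2 ^+ 2 * norm_p a3 b3 c3 d3 ^+ 2).
ring.
Qed.

(** The factors contribute at least 4 + 4 + 6 + 4 powers of 2. *)
Lemma theta_all_odd p q r s a b c d :
  spectrum p -> spectrum q -> spectrum r -> spectrum s ->
  p 0%N = 2 * a + 1 -> q 0%N = 2 * b + 1 -> r 0%N = 2 * c + 1 -> s 0%N = 2 * d + 1 ->
  exists k, theta p q r s = 2 ^+ 15 * k.
Proof.
move=> sp sq sr ss p0 q0 r0 s0.
have [a1 [a2 [a3 [p1 p2 p3]]]] := spectrum_odd sp p0.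
have [b1 [b2 [b3 [q1 q2 q3]]]] := spectrum_odd sq q0.
have [c1 [c2 [c3 [r1 r2 r3]]]] := spectrum_odd sr r0.
have [d1 [d2 [d3 [s1 s2 s3]]]] := spectrum_odd ss s0.
rewrite /theta p0 p1 p2 p3 q0 q1 q2 q3 r0 r1 r2 r3 s0 s1 s2 s3.
have [x ->] : exists x, klein_m (2 * a + 1) (2 * b + 1) (2 * c + 1) (2 * d + 1) = 16 * x.
  exists (((a + b + 1) ^+ 2 - (c + d + 1) ^+ 2) * ((a - b) ^+ 2 - (c - d) ^+ 2)).
  by rewrite /klein_m; ring.
have [y ->] : exists y, klein_p (2 * a1 + 1) (2 * b1 + 1) (2 * c1 + 1) (2 * d1 + 1) = 16 * y.
  exists (((a1 + b1 + 1) ^+ 2 + (c1 + d1 + 1) ^+ 2) * ((a1 - b1) ^+ 2 + (c1 - d1) ^+ 2)).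
  by rewrite /klein_p; ring.
have sqo v := sqr_odd v.
have [z ->] : exists z, norm_m (2 * a2 + 1) (2 * b2 + 1) (2 * c2 + 1) (2 * d2 + 1) = 8 * z.
  have [i ei] := sqo a2; have [j ej] := sqo b2; have [k ek] := sqo c2; have [l el] := sqo d2.
  by exists (i + j - k - l); rewrite /norm_m ei ej ek el; ring.
have [t ->] : exists t, norm_p (2 * a3 + 1) (2 * b3 + 1) (2 * c3 + 1) (2 * d3 + 1) = 4 * t.
  have [i ei] := sqo a3; have [j ej] := sqo b3; have [k ek] := sqo c3; have [l el] := sqo d3.
  by exists (2 * (i + j + k + l) + 1); rewrite /norm_p ei ej ek el; ring.
exists (2 ^+ 3 * x * y * z ^+ 2 * t ^+ 2); ring.
Qed.

(** The powers of 2 are at least 6 + 5 + 2 + 2. Beyond the visible 16, F1 F2 gains 4 and F3 F4 gains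
    2, since [a + b + 1] and [a - b] have opposite parities while [c + d] and [c - d] agree. *)
Lemma theta_odd_odd_even_even p q r s a b c d :
  spectrum p -> spectrum q -> spectrum r -> spectrum s ->
  p 0%N = 2 * a + 1 -> q 0%N = 2 * b + 1 -> r 0%N = 2 * c -> s 0%N = 2 * d ->
  exists k, theta p q r s = 2 ^+ 15 * k.
Proof.
move=> sp sq sr ss p0 q0 r0 s0.
have [a1 [a2 [a3 [p1 p2 p3]]]] := spectrum_odd sp p0.
have [b1 [b2 [b3 [q1 q2 q3]]]] := spectrum_odd sq q0.
have [c1 [c2 [c3 [_ [r1 r2 r3 _]]]]] := spectrum_even sr r0.
have [d1 [d2 [d3 [_ [s1 s2 s3 _]]]]] := spectrum_even ss s0.
rewrite /theta p0 p1 p2 p3 q0 q1 q2 q3 r0 r1 r2 r3 s0 s1 s2 s3.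
have [x ->] : exists x, klein_m (2 * a + 1) (2 * b + 1) (2 * c) (2 * d) = 64 * x.
  have -> : klein_m (2 * a + 1) (2 * b + 1) (2 * c) (2 * d) =
    16 * (((a + b + 1) ^+ 2 - (c + d) ^+ 2) * ((a - b) ^+ 2 - (c - d) ^+ 2)).
    by rewrite /klein_m; ring.
  have sqvk (v k : int) : (v + 2 * k) ^+ 2 - v ^+ 2 = 4 * (v * k + k ^+ 2) by ring.
  have [[k ek]|[k ek]] := even_or_odd (a - b - (c - d)).
    have -> : a - b = c - d + 2 * k by lia.
    by rewrite sqvk; exists (((a + b + 1) ^+ 2 - (c + d) ^+ 2) * ((c - d) * k + k ^+ 2)); ring.
  have -> : a + b + 1 = c + d + 2 * (k + b - d + 1) by lia.
  rewrite sqvk; set k' := k + b - d + 1.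
  by exists (((c + d) * k' + k' ^+ 2) * ((a - b) ^+ 2 - (c - d) ^+ 2)); ring.
have [y ->] : exists y, klein_p (2 * a1 + 1) (2 * b1 + 1) (2 * c1) (2 * d1) = 32 * y.
  have -> : klein_p (2 * a1 + 1) (2 * b1 + 1) (2 * c1) (2 * d1) =
    16 * (((a1 + b1 + 1) ^+ 2 + (c1 + d1) ^+ 2) * ((a1 - b1) ^+ 2 + (c1 - d1) ^+ 2)).
    by rewrite /klein_p; ring.
  have sqvk (v k : int) : (v + 2 * k) ^+ 2 + v ^+ 2 = 2 * (v ^+ 2 + 2 * v * k + 2 * k ^+ 2) by ring.
  have [[k ek]|[k ek]] := even_or_odd (a1 - b1 - (c1 - d1)).
    have -> : a1 - b1 = c1 - d1 + 2 * k by lia.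
    rewrite sqvk; exists (((a1 + b1 + 1) ^+ 2 + (c1 + d1) ^+ 2)
      * ((c1 - d1) ^+ 2 + 2 * (c1 - d1) * k + 2 * k ^+ 2)).
    ring.
  have -> : a1 + b1 + 1 = c1 + d1 + 2 * (k + b1 - d1 + 1) by lia.
  rewrite sqvk; set k' := k + b1 - d1 + 1.
  exists (((c1 + d1) ^+ 2 + 2 * (c1 + d1) * k' + 2 * k' ^+ 2)
    * ((a1 - b1) ^+ 2 + (c1 - d1) ^+ 2)).
  ring.
have [z ->] : exists z, norm_m (2 * a2 + 1) (2 * b2 + 1) (2 * c2) (2 * d2) = 2 * z.
  exists (2 * (a2 ^+ 2 + a2 + b2 ^+ 2 + b2) + 1 - 2 * c2 ^+ 2 - 2 * d2 ^+ 2).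
  by rewrite /norm_m; ring.
have [t ->] : exists t, norm_p (2 * a3 + 1) (2 * b3 + 1) (2 * c3) (2 * d3) = 2 * t.
  exists (2 * (a3 ^+ 2 + a3 + b3 ^+ 2 + b3) + 1 + 2 * c3 ^+ 2 + 2 * d3 ^+ 2).
  by rewrite /norm_p; ring.
exists (x * y * z ^+ 2 * t ^+ 2); ring.
Qed.

Definition even_dets (n : int) :=
  [\/ exists p m, primes_m3_mod8 p /\ n = 2 ^+ 14 * p%:Z * (2 * m + 1),
      exists q m, primes_m1_mod4 q /\ n = 2 ^+ 14 * q%:Z ^+ 2 * (2 * m + 1) |
      exists m, n = 2 ^+ 15 * m].

(** After 2^14 is extracted, the remaining factors are tied to the sums b + d of halves at the four
    characters, whose total is even. *)
Lemma theta_odd_even_odd_even p q r s a b c d :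
  spectrum p -> spectrum q -> spectrum r -> spectrum s ->
  p 0%N = 2 * a + 1 -> q 0%N = 2 * b -> r 0%N = 2 * c + 1 -> s 0%N = 2 * d ->
  even_dets (theta p q r s).
Proof.
move=> sp sq sr ss p0 q0 r0 s0.
have [a1 [a2 [a3 [p1 p2 p3]]]] := spectrum_odd sp p0.
have [b1 [b2 [b3 [i [q1 q2 q3 eb]]]]] := spectrum_even sq q0.
have [c1 [c2 [c3 [r1 r2 r3]]]] := spectrum_odd sr r0.
have [d1 [d2 [d3 [j [s1 s2 s3 ed]]]]] := spectrum_even ss s0.
rewrite /theta p0 p1 p2 p3 q0 q1 q2 q3 r0 r1 r2 r3 s0 s1 s2 s3.
have [f1 [f2 [ekm [e ef]]]] : exists f1 f2,
    klein_m (2 * a + 1) (2 * b) (2 * c + 1) (2 * d) = 64 * (f1 * f2) /\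
    exists e, f1 - f2 = b + d + 2 * e.
  have [t et] := sqr_odd (a + b); have [u eu] := sqr_odd (c + d).
  have [v ev] := sqr_odd (a - b); have [w ew] := sqr_odd (c - d).
  exists (t - u), (v - w); split.
    have -> : klein_m (2 * a + 1) (2 * b) (2 * c + 1) (2 * d) =
      ((2 * (a + b) + 1) ^+ 2 - (2 * (c + d) + 1) ^+ 2)
      * ((2 * (a - b) + 1) ^+ 2 - (2 * (c - d) + 1) ^+ 2) by rewrite /klein_m; ring.
    by rewrite et eu ev ew; ring.
  exists (a * b - c * d - d); move: et eu ev ew; clear; lia.
have [h [ekh [e' eh]]] : exists h,
    norm_m (2 * a2 + 1) (2 * b2) (2 * c2 + 1) (2 * d2) = 4 * h /\
    exists e, h = b2 + d2 + 2 * e.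
  have [t et] := sqr_odd a2; have [u eu] := sqr_odd c2.
  have [v ev] := sqr_parity b2; have [w ew] := sqr_parity d2.
  exists (2 * (t - u) + (b2 + 2 * v) - (d2 + 2 * w)); split.
    by rewrite /norm_m et eu !exprMn ev ew; ring.
  exists (t - u + v - w - d2); ring.
have [k [ekk k_ge0 [e'' ek]]] : exists k,
    [/\ norm_p (2 * a3 + 1) (2 * b3) (2 * c3 + 1) (2 * d3) = 2 * k, 0 <= k &
    exists e, k = 1 + 2 * (b3 + d3) + 4 * e].
  have [t et] := sqr_odd a3; have [u eu] := sqr_odd c3.
  have [v ev] := sqr_parity b3; have [w ew] := sqr_parity d3.
  have e1 : norm_p (2 * a3 + 1) (2 * b3) (2 * c3 + 1) (2 * d3)
      = 2 * (4 * (t + u) + 1 + 2 * (b3 + 2 * v) + 2 * (d3 + 2 * w)).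
    by rewrite /norm_p et eu !exprMn ev ew; ring.
  eexists; split; first exact: e1.
    rewrite -(pmulr_rge0 _ (isT : 0 < 2 :> int)) -e1.
    by rewrite !addr_ge0 ?sqr_ge0.
  exists (t + u + v + w); ring.
have [x [y [z [t [ekp [v ev] [w ew] [e3 e34]]]]]] : exists x y z t : int,
    [/\ klein_p (2 * a1 + 1) (2 * b1) (2 * c1 + 1) (2 * d1)
           = 4 * ((x ^+ 2 + y ^+ 2) * (z ^+ 2 + t ^+ 2)),
        exists v, x ^+ 2 + y ^+ 2 = 4 * v + 1, exists w, z ^+ 2 + t ^+ 2 = 4 * w + 1 &
        exists e, x ^+ 2 + y ^+ 2 - (z ^+ 2 + t ^+ 2) = 4 * (b1 + d1 + 2 * e)].
  exists (a1 + b1 + c1 + d1 + 1), (a1 + b1 - c1 - d1), (a1 - b1 + c1 - d1 + 1), (a1 - b1 - c1 + d1).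
  have aux (m n : int) : exists v, (m + n + 1) ^+ 2 + (m - n) ^+ 2 = 4 * v + 1.
    have [f ef'] := sqr_parity m; have [g eg] := sqr_parity n.
    exists (m + n + f + g).
    have -> : (m + n + 1) ^+ 2 + (m - n) ^+ 2 = 2 * m ^+ 2 + 2 * n ^+ 2 + 2 * m + 2 * n + 1 by ring.
    by rewrite ef' eg; ring.
  split; first by rewrite /klein_p; ring.
  - have [v ev] := aux (a1 + b1) (c1 + d1); exists v; rewrite -ev; ring.
  - have [v ev] := aux (a1 - b1) (c1 - d1); exists v; rewrite -ev; ring.
  - exists (a1 * b1 + c1 * d1); ring.
rewrite ekm ekp ekh ekk.
have -> : 64 * (f1 * f2) * (4 * ((x ^+ 2 + y ^+ 2) * (z ^+ 2 + t ^+ 2))) * (4 * h) ^+ 2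
    * (2 * k) ^+ 2 = 2 ^+ 14 * ((x ^+ 2 + y ^+ 2) * (z ^+ 2 + t ^+ 2) * (f1 * f2 * h) * h * k ^+ 2).
  ring.
(* If f1, f2, h are odd, then b + d is even and b2 + d2 is odd. Hence either
   b3 + d3 is odd and k is 3 mod 4, or b1 + d1 is odd and one of the two sums
   of squares is 5 mod 8. *)
have [[m em]|[m em]] := even_or_odd (f1 * f2 * h).
  apply: Or33; rewrite em.
  exists (m * (x ^+ 2 + y ^+ 2) * (z ^+ 2 + t ^+ 2) * h * k ^+ 2); ring.
have [odd1 odd2 odd3] : [/\ exists u, f1 = 2 * u + 1, exists u, f2 = 2 * u + 1 &
    exists u, h = 2 * u + 1].
  by split; [have [[u eu]|] := even_or_odd f1 | have [[u eu]|] := even_or_odd f2 |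
    have [[u eu]|] := even_or_odd h] => //; move: em; rewrite eu; clear; lia.
have ebd : exists u, b + d = 2 * u.
  case: odd1 odd2 => u eu [u' eu']; exists (u - u' - e).
  by move: ef; rewrite eu eu'; clear; lia.
have ebd2 : exists u, b2 + d2 = 2 * u + 1.
  by case: odd3 => u eu; exists (u - e'); move: eh; rewrite eu; clear; lia.
have [[u eu]|[u eu]] := even_or_odd (b3 + d3); last first.
  have k3 : (`|k| %% 4 = 3)%N by move: k_ge0; rewrite ek eu; clear; lia.
  have [q' [pr qmod /dvdnP[k' ek']]] := prime_factor_3mod4 k3.
  have kE : k = q'%:Z * k'%:Z by rewrite -(gez0_abs k_ge0) ek' PoszM mulrC.
  have q'P : primes_m1_mod4 q' by split=> //; move: qmod; clear; lia.
  rewrite kE.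
  have [[n en]|[n en]] :=
    even_or_odd ((x ^+ 2 + y ^+ 2) * (z ^+ 2 + t ^+ 2) * (f1 * f2 * h) * h * k'%:Z ^+ 2).
    apply: Or33; exists (q'%:Z ^+ 2 * n).
    transitivity (2 ^+ 14 * q'%:Z ^+ 2
      * ((x ^+ 2 + y ^+ 2) * (z ^+ 2 + t ^+ 2) * (f1 * f2 * h) * h * k'%:Z ^+ 2)); first ring.
    by rewrite en; ring.
  by apply: Or32; exists q', n; split=> //; rewrite -en; ring.
(* The sums [4 * v + 1] and [4 * w + 1] differ by 4 (b1 + d1) modulo 8, and here b1 + d1 is odd. *)
have par : exists n, v - w = 2 * n + 1.
  case: ebd ebd2 => n en [n' en']; exists (i + j - n - n' - u - 1 + e3).
  by move: e34 eb ed en en' eu; rewrite ev ew; clear; lia.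
have fin (x' y' n X : int) : x' ^+ 2 + y' ^+ 2 = 8 * n + 5 ->
    even_dets (2 ^+ 14 * ((x' ^+ 2 + y' ^+ 2) * X)).
  move=> /sum_squares_5mod8_factor[p' [l [f [pr pl ->]]]].
  have p'P : primes_m3_mod8 p' by split=> //; rewrite pl; clear; lia.
  have [[n' en]|[n' en]] := even_or_odd (f * X).
    by apply: Or33; exists (p'%:Z * n'); rewrite -mulrA en; ring.
  by apply: Or31; exists p', n'; split=> //; rewrite -en; ring.
have [[n en]|[n en]] := even_or_odd v; last first.
  have := fin x y n ((z ^+ 2 + t ^+ 2) * (f1 * f2 * h) * h * k ^+ 2).
  by rewrite !mulrA; apply; rewrite ev en; ring.
case: par => n' en'.
have := fin z t (n - n' - 1) ((x ^+ 2 + y ^+ 2) * (f1 * f2 * h) * h * k ^+ 2).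
rewrite !mulrA [2 ^+ 14 * _ * _]mulrAC; apply.
by rewrite ew; move: en en'; clear; lia.
Qed.

(** With the next two symmetries, the sixteen parity patterns reduce to the six treated above. *)
Lemma thetaCl (p q r s : nat -> int) : theta q p r s = theta p q r s.
Proof. rewrite /theta /klein_m /klein_p /norm_m /norm_p; congr (_ * _ * _ ^+ 2 * _ ^+ 2); ring. Qed.

Lemma thetaCr (p q r s : nat -> int) : theta p q s r = theta p q r s.
Proof. rewrite /theta /klein_m /klein_p /norm_m /norm_p; congr (_ * _ * _ ^+ 2 * _ ^+ 2); ring. Qed.

(** Exchanging the two pairs negates D1, which enters squared. *)
Lemma thetaC (p q r s : nat -> int) : theta r s p q = theta p q r s.
Proof.
rewrite /theta -[in LHS]sqrrN.
by congr (_ * _ * _ ^+ 2 * _ ^+ 2); rewrite /klein_m /klein_p /norm_m /norm_p; ring.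
Qed.

Lemma theta_values p q r s :
  spectrum p -> spectrum q -> spectrum r -> spectrum s ->
  [\/ exists k, theta p q r s = 16 * k + 1, odd_exceptional_dets (theta p q r s) |
      even_dets (theta p q r s)].
Proof.
move=> sp sq sr ss.
have ev n : (exists k, n = 2 ^+ 15 * k) -> even_dets n by apply: Or33.
have [[a pa]|[a pa]] := even_or_odd (p 0%N);
have [[b qb]|[b qb]] := even_or_odd (q 0%N);
have [[c rc]|[c rc]] := even_or_odd (r 0%N);
have [[d sd]|[d sd]] := even_or_odd (s 0%N).
- by apply/Or33/ev/(theta_all_even sp sq sr ss pa qb rc sd).
- by apply: Or31; rewrite -thetaC -thetaCl; apply: (theta_odd_even_even_even ss sr sp sq sd rc pa qb).
- by apply: Or31; rewrite -thetaC; apply: (theta_odd_even_even_even sr ss sp sq rc sd pa qb).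
- by apply/Or33/ev; rewrite -thetaC; apply: (theta_odd_odd_even_even sr ss sp sq rc sd pa qb).
- by apply: Or31; rewrite -thetaCl; apply: (theta_odd_even_even_even sq sp sr ss qb pa rc sd).
- by apply: Or33; rewrite -thetaCl -thetaCr; apply: (theta_odd_even_odd_even sq sp ss sr qb pa sd rc).
- by apply: Or33; rewrite -thetaCl; apply: (theta_odd_even_odd_even sq sp sr ss qb pa rc sd).
- have [] := theta_odd_even_odd_odd sq sp sr ss qb pa rc sd; rewrite thetaCl; [exact: Or31|exact: Or32].
- by apply: Or31; apply: (theta_odd_even_even_even sp sq sr ss pa qb rc sd).
- by apply: Or33; rewrite -thetaCr; apply: (theta_odd_even_odd_even sp sq ss sr pa qb sd rc).
- by apply: Or33; apply: (theta_odd_even_odd_even sp sq sr ss pa qb rc sd).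
- have [] := theta_odd_even_odd_odd sp sq sr ss pa qb rc sd; [exact: Or31|exact: Or32].
- by apply/Or33/ev/(theta_odd_odd_even_even sp sq sr ss pa qb rc sd).
- have [] := theta_odd_even_odd_odd ss sr sp sq sd rc pa qb;
    rewrite thetaCl thetaC; [exact: Or31|exact: Or32].
- have [] := theta_odd_even_odd_odd sr ss sp sq rc sd pa qb;
    rewrite thetaC; [exact: Or31|exact: Or32].
- by apply/Or33/ev/(theta_all_odd sp sq sr ss pa qb rc sd).
Qed.

(** * Realizing the listed values *)

Lemma spectrumI (v0 v1 v2 v3 : int) :
  (2 %| v1 - v0)%Z -> (2 %| v2 - v0)%Z -> (2 %| v3 - v0)%Z -> (4 %| v0 + v1 + v2 + v3)%Z ->
  spectrum (nth 0 [:: v0; v1; v2; v3]).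
Proof.
move=> /dvdzP[i ei] /dvdzP[j ej] /dvdzP[k ek] /dvdzP[m em].
by exists i, j, k, m; split=> /=; lia.
Qed.

(** The sign of an odd entry is free in the squares and adjusts a quadruple's sum modulo 4. *)
Lemma sqr_sign (x y : int) : exists z k, z ^+ 2 = (2 * x + 1) ^+ 2 /\ z = 2 * y + 1 + 4 * k.
Proof.
have [[u eu]|[u eu]] := even_or_odd (x - y).
  by exists (2 * x + 1), u; split=> //; lia.
by exists (- (2 * x + 1)), (- u - y - 1); split; [rewrite sqrrN|lia].
Qed.

(** Here F1 F2 = (8 m + 1)^2 - (8 m)^2, and the other factors are 1. *)
Lemma theta_value_1mod16 m : theta_value (16 * m + 1).
Proof.
exists (nth 0 [:: 4 * m + 1; 1; 1; 1]), (nth 0 [:: 4 * m; 0; 0; 0]),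
  (nth 0 [:: 4 * m; 0; 0; 0]), (nth 0 [:: 4 * m; 0; 0; 0]).
split; try by apply: spectrumI; lia.
by rewrite /theta /klein_m /klein_p /norm_m /norm_p /=; ring.
Qed.

(* F1 F2 = -128 m, F3 F4 = 4, D1 = 4 or -4, D2 = 2 *)
Lemma theta_value_2pow15 m : theta_value (2 ^+ 15 * m).
Proof.
(* The negation absorbs the sign of F1 F2. The parity of [m] then decides how to make the sums
   divisible by 4. *)
rewrite -[m]opprK; move: (- m) => {}m.
have [[k ->]|[k ->]] := even_or_odd m.
  exists (nth 0 [:: 2 * (2 * k) + 1; 1; 1; 1]), (nth 0 [:: 2 * (2 * k); 0; 0; 0]),
    (nth 0 [:: 2 * (2 * k) + 1; 1; 1; 1]), (nth 0 [:: 2 * (2 * k) - 2; 0; 2; 0]).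
  split; try by apply: spectrumI; lia.
  by rewrite /theta /klein_m /klein_p /norm_m /norm_p /=; ring.
exists (nth 0 [:: 2 * (2 * k + 1) + 1; 1; 1; -1]), (nth 0 [:: 2 * (2 * k + 1); 0; 2; 0]),
  (nth 0 [:: 2 * (2 * k + 1) + 1; 1; 1; -1]), (nth 0 [:: 2 * (2 * k + 1) - 2; 0; 0; 0]).
split; try by apply: spectrumI; lia.
by rewrite /theta /klein_m /klein_p /norm_m /norm_p /=; ring.
Qed.

(** The even root is twice an odd number because p is 5 modulo 8; the odd root is 1 modulo 4 up to
    sign. *)
Lemma prime_5mod8_sum_squares p l : prime p -> p%:Z = 8 * l - 3 ->
  exists e f : int, p%:Z = (4 * e + 1) ^+ 2 + (2 * (2 * f + 1)) ^+ 2.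
Proof.
move=> pr pl; have [|a [b eab]] := prime_sum_two_squares pr; first by move: pl; clear; lia.
have aux (x y : int) : x ^+ 2 + (2 * y) ^+ 2 = p%:Z ->
    exists e f : int, p%:Z = (4 * e + 1) ^+ 2 + (2 * (2 * f + 1)) ^+ 2.
  move=> exy; have [[u eu]|[u eu]] := even_or_odd x.
    by move: exy; rewrite pl eu; clear; lia.
  have [[w ew]|[w ew]] := even_or_odd y.
    have [t et] := sqr_odd u.
    by move: exy; rewrite pl eu ew et; clear; lia.
  have [z [k [ez ek]]] := sqr_sign u 0.
  exists k, w; have -> : 4 * k + 1 = z by rewrite ek; ring.
  by rewrite ez -eu -ew.
have [[u eu]|[u eu]] := even_or_odd b; first by apply: (aux a u); rewrite -eu.
have [[w ew]|[w ew]] := even_or_odd a; first by apply: (aux b w); rewrite -ew addrC.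
by move: eab; rewrite pl eu ew; clear; lia.
Qed.

(** Modulo 4 a sum of squares counts its odd terms. *)
Lemma sum4_3mod4 (n m : int) : n = 4 * m - 1 -> sum4 n -> exists a b c d : int,
  n = (2 * a + 1) ^+ 2 + (2 * b + 1) ^+ 2 + (2 * c + 1) ^+ 2 + (2 * d) ^+ 2.
Proof.
move=> en [a [b [c [d e]]]].
by case: (even_or_odd a) (even_or_odd b) (even_or_odd c) (even_or_odd d)
  => [[a' ea]|[a' ea]] [[b' eb]|[b' eb]] [[c' ec]|[c' ec]] [[d' ed]|[d' ed]];
  rewrite ea eb ec ed in e;
  first [ exfalso; move: e; rewrite en; clear; lia
        | exists b', c', d', a'; rewrite e; ring
        | exists a', c', d', b'; rewrite e; ring
        | exists a', b', d', c'; rewrite e; ring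
        | exists a', b', c', d'; rewrite e; ring ].
Qed.

(* F1 F2 = 64 (2 m + 1), F3 F4 = 4 p, D1 = 4 or -4, D2 = 2 *)
Lemma theta_value_prime_5mod8 p m : primes_m3_mod8 p ->
  theta_value (2 ^+ 14 * p%:Z * (2 * m + 1)).
Proof.
move=> [pr p5]; have [l pl] : exists l, p%:Z = 8 * l - 3.
  by exists ((p%:Z + 3) %/ 8)%Z; move: p5; clear; lia.
have [e [f ->]] := prime_5mod8_sum_squares pr pl.
(* Chosen so that (4x + 1)^2 + (4y + 1)^2 = 2p; the other sum of squares in F3 F4 is 2. *)
pose x := - e - f - 1; pose y := f - e.
have [[k ek]|[k ek]] := even_or_odd (m + x).
  exists (nth 0 [:: 2 * m + 3; 2 * x + 1; 1; -1]), (nth 0 [:: 2 * m; 2 * x; 0; 0]),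
    (nth 0 [:: 2 * m + 1; 2 * y + 1; 1; -1]), (nth 0 [:: 2 * m; 2 * y; 2; 0]).
  split; try by apply: spectrumI; move: ek; rewrite /x /y; clear; lia.
  by rewrite /theta /klein_m /klein_p /norm_m /norm_p /x /y /=; ring.
exists (nth 0 [:: 2 * m + 3; 2 * x + 1; 1; 1]), (nth 0 [:: 2 * m; 2 * x; 2; 0]),
  (nth 0 [:: 2 * m + 1; 2 * y + 1; 1; 1]), (nth 0 [:: 2 * m; 2 * y; 0; 0]).
split; try by apply: spectrumI; move: ek; rewrite /x /y; clear; lia.
by rewrite /theta /klein_m /klein_p /norm_m /norm_p /x /y /=; ring.
Qed.

(* F1 F2 = 64 (2 m + 1), F3 F4 = 4, D1 = 4 or -4, D2 = 2 q *)
Lemma theta_value_prime_3mod4 q m : primes_m1_mod4 q ->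
  theta_value (2 ^+ 14 * q%:Z ^+ 2 * (2 * m + 1)).
Proof.
move=> [pr q3]; have [l ql] : exists l, q%:Z = 4 * l - 1.
  by exists ((q%:Z + 1) %/ 4)%Z; move: q3; clear; lia.
have [a [b [c [d ->]]]] := sum4_3mod4 ql (lagrange_four_squares q).
(* Doubling pairs of squares gives 2q as the sum of the squares of 2(a + b + 1), 2(a - b), 2(c + d)
   + 1 and 2(c - d) + 1; signs of the odd roots fix the sums modulo 4. *)
have [U [i [eU iU]]] := sqr_sign (c + d) (- m - 3).
have [W [j [eW jW]]] := sqr_sign (c - d) (- m - 2).
have [[k ek]|[k ek]] := even_or_odd (m + a + b).
  exists (nth 0 [:: 2 * m + 3; 1; 1; U]), (nth 0 [:: 2 * m; 0; 2; 2 * (a + b + 1)]),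
    (nth 0 [:: 2 * m + 1; 1; 1; W]), (nth 0 [:: 2 * m; 0; 0; 2 * (a - b)]).
  split; try by apply: spectrumI; rewrite ?iU ?jW; move: ek; clear; lia.
  by rewrite /theta /klein_m /klein_p /norm_m /norm_p /= eU eW; ring.
exists (nth 0 [:: 2 * m + 3; 1; 1; U]), (nth 0 [:: 2 * m; 0; 0; 2 * (a + b + 1)]),
  (nth 0 [:: 2 * m + 1; 1; 1; W]), (nth 0 [:: 2 * m; 0; 2; 2 * (a - b)]).
split; try by apply: spectrumI; rewrite ?iU ?jW; move: ek; clear; lia.
by rewrite /theta /klein_m /klein_p /norm_m /norm_p /= eU eW; ring.
Qed.

(* F1 F2 = 8 k - 3, F3 F4 = 8 l - 3, D1 = -1, D2 = 4 m - 1 *)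
Lemma theta_value_exceptional n : odd_exceptional_dets n -> theta_value n.
Proof.
move=> [k [l [m [m1 [p [pr _] pl] par ->]]]].
have [e [f ef]] := prime_5mod8_sum_squares pr (esym pl).
have s4 : sum4 (4 * m - 1).
  have -> : 4 * m - 1 = `|(4 * m - 1)%R|%N%:Z by rewrite gez0_abs; lia.
  exact: lagrange_four_squares.
have [a [b [c [d ed]]]] := sum4_3mod4 (erefl _) s4.
have [U [u [eU iU]]] := sqr_sign a (- k - e - 1).
have [W [w [eW iW]]] := sqr_sign b (- k - f - 1).
have [Z [z [eZ iZ]]] := sqr_sign c (- k - f - 1).
exists (nth 0 [:: 2 * k - 1; 2 * e + 1; 1; U]), (nth 0 [:: 2 * k; 2 * e; 0; 2 * d]),
  (nth 0 [:: 2 * k - 1; 2 * f + 1; 1; W]), (nth 0 [:: 2 * k - 1; 2 * f + 1; 1; Z]).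
(* Modulo 2, [l] is 1 + e and [m] is 1 + d, so the hypothesis on [k + l] is the divisibility
   required of the second quadruple. *)
have parq : exists t, k + e + d = 2 * t.
  have [v ev] := sqr_parity d; have [t1 et1] := sqr_odd f; have [t2 et2] := sqr_odd a.
  have [t3 et3] := sqr_odd b; have [t4 et4] := sqr_odd c.
  have el : exists t, l = (1 + e) + 2 * t.
    by apply: ex_quotient; move: ef; rewrite -pl exprMn et1; clear; lia.
  have em : exists t, m = (1 + d) + 2 * t.
    by apply: ex_quotient; move: ed; rewrite et2 et3 et4 exprMn ev; clear; lia.
  case: el em => x ex [y ey]; exists ((k + e + d) %/ 2)%Z; move: par; rewrite ex ey; clear; lia.
split; try by apply: spectrumI; rewrite ?iU ?iW ?iZ; case: parq => t; clear; lia.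
rewrite ed pl ef /theta /klein_m /klein_p /norm_m /norm_p /= eU eW eZ; ring.
Qed.

(** Strictness is witnessed by 9, whose only prime factor 3 is not 5 modulo 8. *)
Lemma exceptional_strict : odd_exceptional_dets `<` [set 16 * m - 7 | m in [set: int]].
Proof.
split=> [n [k [l [m [_ [p _ pl] par ->]]]]|sub].
  have [t et] : exists t, k = (m - l) + 2 * t.
    by apply: ex_quotient; move: par; clear; lia.
  have [e ee] : exists e, (8 * k - 3) * (8 * l - 3) * (4 * m - 1) ^+ 2 = - 7 + 16 * e.
    by rewrite et; apply: ex_quotient; clear; lia.
  by exists e => //; rewrite ee addrC.
have [k [l [m [m1 [p [pr p5] pl] _ e]]]] : odd_exceptional_dets 9 by apply: sub; exists 1.
have : (p %| 9)%N.
  have : (p%:Z %| (8 * k - 3) * (8 * l - 3) * (4 * m - 1) ^+ 2)%Z.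
    by rewrite pl dvdz_mulr // dvdz_mull.
  by rewrite -e.
rewrite -[9%N]/(3 ^ 2)%N (Euclid_dvdX _ _ pr) andbT dvdn_prime2 // => /eqP p3.
by move: p5; rewrite p3.
Qed.

Theorem theorem1p1 (gT : finGroupType) (G : {group gT})
    (isoG : (G \isog Grp (g1 : g2 :
               g1 ^+ 4 = g2 ^+ 4 = 1, g2 * g1 = g1 ^+ 3 * g2))%g) :
  odd_exceptional_dets `<` [set 16 * m - 7 | m in [set: int]] /\
  int_group_dets G =
    [set 16 * m + 1 | m in [set: int]]
    `|` [set 2 ^+ 14 * p%:Z * (2 * m + 1)
          | p in primes_m3_mod8 & m in [set: int]]
    `|` [set 2 ^+ 14 * q%:Z ^+ 2 * (2 * m + 1)
          | q in primes_m1_mod4 & m in [set: int]]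
    `|` [set 2 ^+ 15 * m | m in [set: int]]
    `|` odd_exceptional_dets.
Proof.
split; first exact: exceptional_strict.
apply/seteqP; split=> n.
  move=> /(int_group_detsP isoG)[p [q [r [s [sp sq sr ss ->]]]]].
  have [[k ->]|exc|[[p' [m [p'P ->]]]|[q' [m [q'P ->]]]|[m ->]]] := theta_values sp sq sr ss.
  - by do 4 left; exists k.
  - by right.
  - by do 3 left; right; exists p' => //; exists m.
  - by do 2 left; right; exists q' => //; exists m.
  - by left; right; exists m.
move=> valn; apply/(int_group_detsP isoG); move: valn.
move=> [[[[[m _ <-]|[p pP [m _ <-]]]|[q qP [m _ <-]]]|[m _ <-]]|exc].
- exact: theta_value_1mod16.
- exact: theta_value_prime_5mod8.
- exact: theta_value_prime_3mod4.
- exact: theta_value_2pow15.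
- exact: theta_value_exceptional.
Qed.
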